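(* Let $\alpha$ be an automorphism of a unital $C^*$-algebra $A$ and let $A^\alpha=\{a\in A\mid \alpha(a)=a\}$ be its fixed-point subalgebra. Then the following five statements are equivalent: (i) Every bounded linear functional on $A^\alpha$ has a unique bounded, $\alpha$-invariant linear extension to $A$. (ii) Every state of $A^\alpha$ has a unique $\alpha$-invariant state extension to $A$. (iii) The subspace $A^\alpha+\{a-\alpha(a)\mid a\in A\}$ is norm-dense in $A$. (iv) For every $a\in A$ the sequence of ergodic averages $\frac1n\sum_{k=0}^{n-1}\alpha^k(a)$ converges in norm as $n\to\infty$. (v) $A^\alpha+\overline{\{a-\alpha(a)\mid a\in A\}}=A$, where the closure is in norm. Moreover, (i)–(v) imply: (vi) There exists a unique $\alpha$-invariant conditional expectation $E$ from $A$ onto $A^\alpha$ (i.e. $E\circ\alpha=E$); and when (i)–(v) hold, this $E$ is given by $E(a)=\lim_{n\to\infty}\frac1n\sum_{k=0}^{n-1}\alpha^k(a)$ for all $a\in A$.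
   Context: A conditional expectation from a $C^*$-algebra $A$ onto a $C^*$-subalgebra $B$ is a linear projection of norm one from $A$ onto $B$. A state is a positive linear functional of norm one. *)

(* Defs.v *)
From HB Require Import structures.
From mathcomp Require Import all_boot all_order all_algebra.
From mathcomp Require Import complex.
From mathcomp Require Import all_classical all_reals topology normedtype sequences.
Import Order.TTheory GRing.Theory Num.Theory numFieldNormedType.Exports.

Set Implicit Arguments.
Unset Strict Implicit.
Unset Printing Implicit Defensive.

Local Open Scope ring_scope.
Local Open Scope classical_set_scope.

Record CStarAlgebra (R : realType) (A : completeNormedModType R[i]) := {
  cmul : A -> A -> A;
  cone : A;
  cstar : A -> A;
  cmulA : forall x y z, cmul x (cmul y z) = cmul (cmul x y) z;
  cmul1l : forall x, cmul cone x = x;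
  cmul1r : forall x, cmul x cone = x;
  cmulDl : forall x y z, cmul (x + y) z = cmul x z + cmul y z;
  cmulDr : forall x y z, cmul x (y + z) = cmul x y + cmul x z;
  cmulZl : forall (c : R[i]) x y, cmul (c *: x) y = c *: cmul x y;
  cmulZr : forall (c : R[i]) x y, cmul x (c *: y) = c *: cmul x y;
  cone_neq0 : cone != 0;
  cnorm_mul : forall x y, `|cmul x y| <= `|x| * `|y|;
  cstarD : forall x y, cstar (x + y) = cstar x + cstar y;
  cstarZ : forall (c : R[i]) x, cstar (c *: x) = c^* *: cstar x;
  cstarK : forall x, cstar (cstar x) = x;
  cstarM : forall x y, cstar (cmul x y) = cmul (cstar y) (cstar x);
  cstar_identity : forall x, `|cmul (cstar x) x| = `|x| ^+ 2
}.

Section Defs.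
Variables (R : realType) (A : completeNormedModType R[i]) (cA : CStarAlgebra A).

Definition is_automorphism (alpha : A -> A) : Prop :=
  bijective alpha /\
  (forall x y, alpha (x + y) = alpha x + alpha y) /\
  (forall (c : R[i]) x, alpha (c *: x) = c *: alpha x) /\
  (forall x y, alpha (cmul cA x y) = cmul cA (alpha x) (alpha y)) /\
  alpha (cone cA) = cone cA /\
  (forall x, alpha (cstar cA x) = cstar cA (alpha x)).

Definition fixed_pts (alpha : A -> A) : set A := [set a | alpha a = a].

(* linear functional on the subspace B (values outside B are irrelevant) *)
Definition linear_on (B : set A) (f : A -> R[i]) : Prop :=
  (forall x y, B x -> B y -> f (x + y) = f x + f y) /\
  (forall (c : R[i]) x, B x -> f (c *: x) = c * f x).

Definition bounded_on (B : set A) (f : A -> R[i]) : Prop :=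
  exists M : R[i], forall x, B x -> `|f x| <= M * `|x|.

Definition norm_one_on (B : set A) (f : A -> R[i]) : Prop :=
  (forall x, B x -> `|f x| <= `|x|) /\
  (forall e : R[i], 0 < e -> exists x, B x /\ `|x| <= 1 /\ 1 - e < `|f x|).

Definition positive_on (B : set A) (f : A -> R[i]) : Prop :=
  forall b, B b -> 0 <= f (cmul cA (cstar cA b) b).

Definition state_on (B : set A) (f : A -> R[i]) : Prop :=
  linear_on B f /\ positive_on B f /\ norm_one_on B f.

Definition cond_exp (B : set A) (E : A -> A) : Prop :=
  (forall x y, E (x + y) = E x + E y) /\
  (forall (c : R[i]) x, E (c *: x) = c *: E x) /\
  (forall x, B (E x)) /\
  (forall x, B x -> E x = x) /\
  (forall x, `|E x| <= `|x|) /\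
  (forall e : R[i], 0 < e -> exists x, `|x| <= 1 /\ 1 - e < `|E x|).

Definition coboundaries (alpha : A -> A) : set A := [set a - alpha a | a in setT].

Definition set_sum (S T : set A) : set A :=
  [set z | exists x y, S x /\ T y /\ z = x + y].

Definition ergodic_avg (alpha : A -> A) (a : A) (n : nat) : A :=
  (n%:R)^-1 *: \sum_(k < n) iter k alpha a.

End Defs.

(* Main.v *)
Require Import Defs.
From HB Require Import structures.
From mathcomp Require Import all_boot all_order all_algebra.
From mathcomp Require Import complex.
From mathcomp Require Import all_classical all_reals topology normedtype sequences.
From mathcomp Require Import ring lra.
Import Order.TTheory GRing.Theory Num.Theory numFieldNormedType.Exports.
Local Open Scope ring_scope.
Local Open Scope classical_set_scope.
Local Open Scope complex_scope.

Set Implicit Arguments.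
Unset Strict Implicit.
Unset Printing Implicit Defensive.

(* Density of A^α + {a - α(a)} gives convergence of the averages, because they
   are contractions which converge on that subspace; the limit E maps A into
   A^α, and composing with E produces the required extensions, while an
   invariant bounded functional is determined by its values on the dense
   subspace.  For the converse, if the subspace misses a self-adjoint x0 by a
   distance d > 0, consider on A ⊕ A the functional
     (X + m, -X + w + m) |-> l d + m,
   where X = l x0 + s with s in the subspace and w is a coboundary.  Averaging
   shows that it is positive, so by M. Riesz it extends to a positive functional
   on A ⊕ A; its two components are, up to normalisation, invariant states
   which agree on A^α and differ at x0.

   The C*-theory is obtained without spectra.  Square roots of 1 - a, |a| <= 1,
   come from the iteration y <- (a + y^2)/2.  If k and r are commuting and
   self-adjoint with k^2 + r^2 = 1, then k + i r is an isometry and |k| <= 1: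
   this yields the contractivity of automorphisms, the calculus of positive
   elements (squares of self-adjoint ones), and finally b^*b >= 0. *)

(** * Linear identities in a module, decided by reflection *)

Section LinearIdentities.
Variables (K : comNzRingType) (V : lmodType K).

Inductive lin_expr :=
  | LVar of nat | LZero | LAdd of lin_expr & lin_expr | LOpp of lin_expr
  | LScale of K & lin_expr.

Fixpoint lin_eval (vs : seq V) (e : lin_expr) : V :=
  match e with
  | LVar n => nth 0 vs n
  | LZero => 0
  | LAdd e1 e2 => lin_eval vs e1 + lin_eval vs e2
  | LOpp e => - lin_eval vs e
  | LScale c e => c *: lin_eval vs e
  end.

Fixpoint lin_coef (e : lin_expr) (i : nat) : K :=
  match e with
  | LVar n => if eqn n i then 1 else 0
  | LZero => 0
  | LAdd e1 e2 => lin_coef e1 i + lin_coef e2 i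
  | LOpp e => - lin_coef e i
  | LScale c e => c * lin_coef e i
  end.

(** A recursive conjunction instead of a quantifier over indices, so that [cbn] unfolds it into one
    scalar equation per atom. *)
Fixpoint lin_agree (e1 e2 : lin_expr) (n : nat) : Prop :=
  if n is n'.+1 then lin_agree e1 e2 n' /\ lin_coef e1 n' = lin_coef e2 n'
  else True.

Lemma lin_evalE vs e :
  lin_eval vs e = \sum_(i < size vs) lin_coef e i *: nth 0 vs i.
Proof.
elim: e => [n||e1 IH1 e2 IH2|e IH|c e IH] /=.
- have [nvs|nvs] := ltnP n (size vs).
    rewrite (bigD1 (Ordinal nvs)) //= eqnE eqxx scale1r big1 ?addr0// => i.
    rewrite -val_eqE /= eq_sym => /negbTE ->; exact: scale0r.
  rewrite nth_default// big1// => i _; rewrite eqnE; case: eqP => [e|_].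
    by move: (ltn_ord i); rewrite -e ltnNge nvs.
  by rewrite scale0r.
- by rewrite big1// => i _; rewrite scale0r.
- by rewrite IH1 IH2 -big_split; apply: eq_bigr => i _; rewrite scalerDl.
- by rewrite IH -sumrN; apply: eq_bigr => i _; rewrite scaleNr.
- by rewrite IH scaler_sumr; apply: eq_bigr => i _; rewrite scalerA.
Qed.

Lemma lin_agree_eval vs e1 e2 :
  lin_agree e1 e2 (size vs) -> lin_eval vs e1 = lin_eval vs e2.
Proof.
move=> H; rewrite !lin_evalE; apply: eq_bigr => -[i /= ilt] _; congr (_ *: _).
elim: (size vs) H ilt => //= n IH [H1 H2]; rewrite ltnS leq_eqVlt.
by move=> /predU1P[->//|/(IH H1)].
Qed.

End LinearIdentities.

Ltac lin_mem x vs :=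
  match vs with
  | [::] => constr:(false)
  | x :: _ => constr:(true)
  | _ :: ?vs' => lin_mem x vs'
  end.
Ltac lin_index x vs :=
  match vs with
  | x :: _ => constr:(0%N)
  | _ :: ?vs' => let n := lin_index x vs' in constr:(S n)
  end.
Ltac lin_atoms vs e :=
  match e with
  | 0 => vs
  | ?a + ?b => let vs1 := lin_atoms vs a in lin_atoms vs1 b
  | - ?a => lin_atoms vs a
  | _ *: ?a => lin_atoms vs a
  | _ => match lin_mem e vs with true => vs | false => constr:(e :: vs) end
  end.
Ltac lin_reify K vs e :=
  match e with
  | 0 => constr:(LZero K)
  | ?a + ?b => let ra := lin_reify K vs a in let rb := lin_reify K vs b in
               constr:(LAdd ra rb)
  | - ?a => let ra := lin_reify K vs a in constr:(LOpp ra)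
  | ?c *: ?a => let ra := lin_reify K vs a in constr:(LScale (c : K) ra)
  | _ => let n := lin_index e vs in constr:(LVar K n)
  end.
(* Decides identities between linear combinations of atoms of a vector space
   over K, by comparing coefficients with [field]. *)
Ltac linear_identity K :=
  match goal with
  | |- @eq ?V ?a ?b =>
    let vs0 := lin_atoms constr:(@nil V) a in
    let vs := lin_atoms vs0 b in
    let ra := lin_reify K vs a in
    let rb := lin_reify K vs b in
    apply: (@lin_agree_eval _ _ vs ra rb);
    cbn [lin_agree size lin_coef eqn];
    repeat split; try by field
  end.

(** * Real-valued norm, limits and closures *)

Section RealNorm.
Variables (R : realType) (A : completeNormedModType R[i]).
Implicit Types (x y z : A) (t s : R).

(** The norm of [A] takes values in [R[i]]; as an element of [R] it can be handled by [lra] and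
    [nra]. *)
Definition rnorm x : R := complex.Re `|x|.

Lemma rnormE x : `|x| = (rnorm x)%:C.
Proof. by rewrite /rnorm RRe_real// normr_real. Qed.

Lemma rnorm_ge0 x : 0 <= rnorm x.
Proof. by rewrite -ler0c -rnormE. Qed.

Lemma rnorm_eq0 x : rnorm x = 0 -> x = 0.
Proof. by move=> x0; apply/normr0_eq0; rewrite rnormE x0. Qed.

Lemma rnorm0 : rnorm 0 = 0.
Proof. by rewrite /rnorm normr0. Qed.

Lemma rnormD x y : rnorm (x + y) <= rnorm x + rnorm y.
Proof. by rewrite -lecR rmorphD /= -!rnormE ler_normD. Qed.

Lemma rnormN x : rnorm (- x) = rnorm x.
Proof. by rewrite /rnorm normrN. Qed.

Lemma rnormBC x y : rnorm (x - y) = rnorm (y - x).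
Proof. by rewrite -rnormN opprB. Qed.

Lemma rnormB x y : rnorm (x - y) <= rnorm x + rnorm y.
Proof. by rewrite -(rnormN y) rnormD. Qed.

Lemma rnormZ (c : R[i]) x : rnorm (c *: x) = complex.Re `|c| * rnorm x.
Proof.
by apply: complexI; rewrite rmorphM /= -!rnormE normrZ.
Qed.

Lemma normcR t : `|t%:C| = `|t|%:C.
Proof. by rewrite normc_def /= expr0n /= addr0 sqrtr_sqr. Qed.

Lemma rnormZr t x : 0 <= t -> rnorm (t%:C *: x) = t * rnorm x.
Proof. by move=> t0; rewrite rnormZ normcR /= ger0_norm. Qed.

Definition rcvg (u : nat -> A) (l : A) :=
  forall e : R, 0 < e -> exists N, forall n, (N <= n)%N -> rnorm (u n - l) < e.

(** Numbers of [R[i]] are comparable only when their imaginary parts agree, so complex and real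
    epsilons amount to the same. *)
Lemma gt0_complex (e : R[i]) : 0 < e -> exists2 r : R, 0 < r & e = r%:C.
Proof.
move=> e0; have er : e \is Num.real by apply: gtr0_real.
by exists (complex.Re e); rewrite -?ltcR RRe_real.
Qed.

Lemma rcvgP (u : nat -> A) l : rcvg u l <-> u @ \oo --> l.
Proof.
split=> [ul|/cvgrPdistC_lt ul e e0].
  apply/cvgrPdistC_lt => e /gt0_complex[r r0 ->].
  have [N HN] := ul _ r0; exists N => // n /= /HN.
  by rewrite rnormE ltcR.
have [|N _ HN] := ul e%:C; first by rewrite ltcR.
by exists N => n /HN /=; rewrite rnormE ltcR.
Qed.

Lemma rclosureP (S : set A) x :
  closure S x <-> forall e, 0 < e -> exists2 s, S s & rnorm (x - s) < e.
Proof.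
split=> [xS e e0|xS B].
  have [|s [Ss /=]] := xS (ball x e%:C).
    by apply: nbhsx_ballx; rewrite ltcR.
  by rewrite -ball_normE /= rnormE ltcR; exists s.
move=> /nbhs_ballP[e /= /gt0_complex[r r0 ->]] rB.
have [s Ss xs] := xS _ r0; exists s; split => //; apply: rB.
by rewrite -ball_normE /= rnormE ltcR.
Qed.

Lemma rcauchy_cvg (u : nat -> A) :
  (forall e, 0 < e -> exists N, forall m n, (N <= m)%N -> (N <= n)%N ->
    rnorm (u m - u n) < e) -> exists l, rcvg u l.
Proof.
move=> cu; suff uc : cvg (u @ \oo) by exists (lim (u @ \oo)); apply/rcvgP.
apply/cauchy_cvgP/cauchy_exP => e /gt0_complex[r r0 ->].
have [N HN] := cu _ r0; exists (u N); exists N => // n /= Nn.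
by rewrite -ball_normE /= rnormE ltcR; apply: HN.
Qed.

End RealNorm.

(** * Square roots and positive elements *)

Section CStarBasics.
Variables (R : realType) (A : completeNormedModType R[i]) (cA : CStarAlgebra A).
Implicit Types (x y z h k : A) (t s : R).

Local Notation "x ** y" := (cmul cA x y) (at level 40, left associativity).
Local Notation "x ^†" := (cstar cA x) (at level 2, format "x ^†").
Local Notation "1c" := (cone cA).

Lemma cmulNl x y : (- x) ** y = - (x ** y).
Proof. by rewrite -scaleN1r cmulZl scaleN1r. Qed.

Lemma cmulNr x y : x ** (- y) = - (x ** y).
Proof. by rewrite -scaleN1r cmulZr scaleN1r. Qed.

Lemma cmulBl x y z : (x - y) ** z = x ** z - y ** z.
Proof. by rewrite cmulDl cmulNl. Qed.

Lemma cmulBr x y z : x ** (y - z) = x ** y - x ** z.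
Proof. by rewrite cmulDr cmulNr. Qed.

Lemma cmul0l x : 0 ** x = 0.
Proof. by apply: (@addIr _ (0 ** x)); rewrite -cmulDl !add0r. Qed.

Lemma cmul0r x : x ** 0 = 0.
Proof. by apply: (@addIr _ (x ** 0)); rewrite -cmulDr !add0r. Qed.

Definition cmulE := (cmulDl, cmulDr, cmulBl, cmulBr, cmulNl, cmulNr, cmulZl,
  cmulZr, cmul1l, cmul1r, cmul0l, cmul0r).

Lemma cstarN x : (- x)^† = - x^†.
Proof. by rewrite -scaleN1r cstarZ rmorphN1 scaleN1r. Qed.

Lemma cstarB x y : (x - y)^† = x^† - y^†.
Proof. by rewrite cstarD cstarN. Qed.

Lemma cstar0 : 0^† = 0.
Proof. by apply: (@addIr _ 0^†); rewrite -cstarD !add0r. Qed.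

Lemma cstarZr t x : (t%:C *: x)^† = t%:C *: x^†.
Proof. by rewrite cstarZ; congr (_ *: _); exact: conjc_real. Qed.

Lemma cstar1 : 1c^† = 1c.
Proof. by rewrite -[LHS](cmul1l cA) -{1}(cstarK cA 1c) -cstarM cmul1l cstarK. Qed.

Lemma rnormM x y : rnorm (x ** y) <= rnorm x * rnorm y.
Proof. by rewrite -lecR rmorphM /= -!rnormE cnorm_mul. Qed.

Lemma rnorm_starM x : rnorm (x^† ** x) = rnorm x ^+ 2.
Proof. by apply: complexI; rewrite rmorphXn /= -!rnormE cstar_identity. Qed.

(** Cancel |z| in |z|^2 = |z^† z| <= |z^†| |z|, then exchange z and z^†. *)
Lemma rnorm_star x : rnorm x^† = rnorm x.
Proof.
suff le_star z : rnorm z <= rnorm z^†.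
  by apply: le_anti; rewrite le_star andbT -{2}(cstarK cA x) le_star.
have := rnormM z^† z; rewrite rnorm_starM.
by have := rnorm_ge0 z; have := rnorm_ge0 z^†; nra.
Qed.

Lemma rnorm1 : rnorm 1c = 1.
Proof.
have := rnorm_starM 1c; rewrite cstar1 cmul1l => e.
have n0 : rnorm 1c != 0 by apply: contra (cone_neq0 cA) => /eqP/rnorm_eq0 ->.
by apply: (mulfI n0); rewrite mulr1 {3}e.
Qed.

Definition cself x := x^† = x.
Definition ccomm x y := x ** y = y ** x.

Lemma rnorm_self_sq h : cself h -> rnorm (h ** h) = rnorm h ^+ 2.
Proof. by move=> hs; rewrite -rnorm_starM hs. Qed.

Lemma ccomm_sym x y : ccomm x y -> ccomm y x. Proof. by []. Qed.

Lemma ccomm1 x : ccomm x 1c.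
Proof. by rewrite /ccomm !cmulE. Qed.

Lemma ccommD x y z : ccomm x y -> ccomm x z -> ccomm x (y + z).
Proof. by rewrite /ccomm !cmulE => -> ->. Qed.

Lemma ccommB x y z : ccomm x y -> ccomm x z -> ccomm x (y - z).
Proof. by rewrite /ccomm !cmulE => -> ->. Qed.

Lemma ccommM x y z : ccomm x y -> ccomm x z -> ccomm x (y ** z).
Proof. by rewrite /ccomm => xy xz; rewrite cmulA xy -cmulA xz cmulA. Qed.

Lemma ccommZ x y (c : R[i]) : ccomm x y -> ccomm x (c *: y).
Proof. by rewrite /ccomm !cmulE => ->. Qed.

(* If k and r are commuting self-adjoint elements with k^2 + r^2 = 1 then
   u = k + i r is an isometry and k = (u + u^† ) / 2. *)
Lemma rnorm_circle_le1 k r : cself k -> cself r -> ccomm k r ->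
  k ** k + r ** r = 1c -> rnorm k <= 1.
Proof.
move=> ks rs kr kr1; pose u := k + 'i *: r.
have us : u^† = k - 'i *: r.
  by rewrite /u cstarD cstarZ ks rs -scaleNr; congr (_ + _ *: _); rewrite /= -conjCi.
have nu : rnorm u = 1.
  have : u^† ** u = 1c.
    rewrite us /u -kr1 !cmulE kr scalerA -expr2 sqr_i.
    linear_identity R[i].
  move=> /(congr1 (@rnorm _ A)); rewrite rnorm_starM rnorm1 => /eqP.
  by rewrite sqrp_eq1 ?rnorm_ge0// => /eqP.
have -> : k = (2^-1)%:C *: (u + u^†).
  rewrite us /u; linear_identity R[i].
rewrite rnormZr ?invr_ge0//; have := rnormD u u^†; rewrite rnorm_star nu; lra.
Qed.

End CStarBasics.

(** * Closed conditions under norm limits *)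

Section RealLimits.
Variables (R : realType) (A : completeNormedModType R[i]).
Implicit Types (x y l : A) (u : nat -> A).

Lemma rnorm_lt_eq0 x : (forall e, 0 < e -> rnorm x < e) -> x = 0.
Proof.
move=> x0; apply: rnorm_eq0; apply: le_anti; rewrite rnorm_ge0 andbT.
by apply/ler_addgt0Pr => e /x0 /ltW; rewrite add0r.
Qed.

(** Self-adjointness, commutation with a given element and invariance under an automorphism are all
    equations of this form, hence pass to limits. *)
Lemma rcvg_lipschitz0 (f : A -> A) (C : R) u l :
  (forall x y, rnorm (f x - f y) <= C * rnorm (x - y)) ->
  (forall n, f (u n) = 0) -> rcvg u l -> f l = 0.
Proof.
move=> fC fu ul; apply: rnorm_lt_eq0 => e e0.
have C0 : 0 < `|C| + 1 by have := normr_ge0 C; lra.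
have [|N /(_ N (leqnn N)) HN] := ul (e / (`|C| + 1)); first exact: divr_gt0.
have := fC (u N) l; rewrite fu sub0r rnormN => /le_lt_trans; apply.
move: HN; rewrite ltr_pdivlMr//; apply: le_lt_trans.
by have := ler_norm C; have := rnorm_ge0 (u N - l); nra.
Qed.

Lemma rcvg_rnorm_le u l (C : R) :
  (forall n, rnorm (u n) <= C) -> rcvg u l -> rnorm l <= C.
Proof.
move=> uC ul; apply/ler_addgt0Pr => e /ul[N /(_ N (leqnn N))].
rewrite rnormBC => HN; have := rnormD (l - u N) (u N); rewrite subrK.
by have := uC N; lra.
Qed.

End RealLimits.

(** * Square roots of 1 - a by iteration *)

Section SquareRoot.
Variables (R : realType) (A : completeNormedModType R[i]) (cA : CStarAlgebra A).

Local Notation "x ** y" := (cmul cA x y) (at level 40, left associativity).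
Local Notation "x ^†" := (cstar cA x) (at level 2, format "x ^†").
Local Notation "1c" := (cone cA).
Implicit Types (x y z h k a : A) (t s : R).

Lemma rcvg_cself (u : nat -> A) l : (forall n, cself cA (u n)) -> rcvg u l -> cself cA l.
Proof.
move=> us ul; apply/eqP; rewrite -subr_eq0; apply/eqP.
apply: (@rcvg_lipschitz0 _ _ (fun x => x^† - x) 2) ul => [x y|n]; last first.
  by rewrite us subrr.
have -> : x^† - x - (y^† - y) = (x - y)^† - (x - y).
  by rewrite cstarB; linear_identity R[i].
by have := rnormB (x - y)^† (x - y); rewrite rnorm_star; lra.
Qed.

Lemma rcvg_ccomm (u : nat -> A) l x :
  (forall n, ccomm cA x (u n)) -> rcvg u l -> ccomm cA x l.
Proof.
move=> us ul; apply/eqP; rewrite -subr_eq0; apply/eqP.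
apply: (@rcvg_lipschitz0 _ _ (fun z => x ** z - z ** x) (2 * rnorm x)) ul => [z y|n].
  have -> : x ** z - z ** x - (x ** y - y ** x) = x ** (z - y) - (z - y) ** x.
    by rewrite !cmulE; linear_identity R[i].
  have := rnormB (x ** (z - y)) ((z - y) ** x).
  by have := rnormM cA x (z - y); have := rnormM cA (z - y) x; lra.
by rewrite us subrr.
Qed.

(** A fixed point y satisfies 2y = a + y^2, that is (1 - y)^2 = 1 - a. *)
Fixpoint sqrt_iter a n : A :=
  if n is n'.+1 then (2^-1)%:C *: (a + sqrt_iter a n' ** sqrt_iter a n') else 0.

(* The scalar iteration that dominates [sqrt_iter a] when |a| <= 1. *)
Fixpoint sqrt_majorant (n : nat) : R :=
  if n is n'.+1 then (1 + sqrt_majorant n' ^+ 2) / 2 else 0.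

(** An explicit rate of convergence to 1, which makes the dominated iteration Cauchy even when |a| =
    1. The induction works because, with d = n + 2, one step from 1 - 2/d exceeds 1 - 2/(d + 1) by
    2/(d^2 (d + 1)). *)
Lemma sqrt_majorant_bounds n :
  1 - 2 / (n.+2)%:R <= sqrt_majorant n <= 1.
Proof.
elim: n => [|n /andP[IH1 IH2]] /=; first by lra.
have n0 : (0 : R) < n.+2%:R by rewrite ltr0n.
have n1 : (n.+3%:R : R) = n.+2%:R + 1 by rewrite -[in LHS]addn1 natrD.
rewrite n1; set d := (n.+2%:R : R) in n0 IH1 *.
have d2 : 2 <= d by rewrite /d ler_nat.
have s0 : 0 <= 1 - 2 / d by rewrite subr_ge0 ler_pdivrMr ?mul1r//; lra.
have sn0 := le_trans s0 IH1.
apply/andP; split; last by nra.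
have sq : (1 - 2 / d) ^+ 2 <= sqrt_majorant n ^+ 2 by rewrite ler_sqr ?nnegrE.
suff : 1 - 2 / (d + 1) <= (1 + (1 - 2 / d) ^+ 2) / 2.
  by move=> /le_trans; apply; rewrite ler_pM2r ?invr_gt0// lerD2l.
rewrite -subr_ge0.
have -> : (1 + (1 - 2 / d) ^+ 2) / 2 - (1 - 2 / (d + 1)) =
  2 / (d ^+ 2 * (d + 1)) by field; lra.
by rewrite divr_ge0// mulr_ge0// ?sqr_ge0//; lra.
Qed.

(** The factorisation x^2 - y^2 = x(x - y) + (x - y)y needs no commutation. *)
Lemma rnorm_sub_sq_le x y : rnorm (x ** x - y ** y) <= rnorm (x - y) * (rnorm x + rnorm y).
Proof.
have -> : x ** x - y ** y = x ** (x - y) + (x - y) ** y.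
  by rewrite !cmulE; linear_identity R[i].
apply: (le_trans (rnormD _ _)).
by have := rnormM cA x (x - y); have := rnormM cA (x - y) y; lra.
Qed.

(** Both iterations subtract squares: the step multiplies the distance by at most half the sum of
    the norms, while the majorant difference is multiplied by exactly half the sum of the
    majorants. *)
Lemma sqrt_iter_dist a n m : rnorm a <= 1 ->
  rnorm (sqrt_iter a (n + m) - sqrt_iter a n) <= sqrt_majorant (n + m) - sqrt_majorant n.
Proof.
move=> a1; have it0 (k : nat) : rnorm (sqrt_iter a k) <= sqrt_majorant k.
  elim: k => [|k IH] /=; first by rewrite rnorm0.
  rewrite rnormZr ?invr_ge0//.
  have := rnormD a (sqrt_iter a k ** sqrt_iter a k).
  have := rnormM cA (sqrt_iter a k) (sqrt_iter a k).
  by have := rnorm_ge0 (sqrt_iter a k); nra.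
elim: n => [|n IH]; first by rewrite add0n !subr0.
rewrite addSn /= -scalerBr rnormZr ?invr_ge0//.
rewrite opprD addrACA subrr add0r.
have := rnorm_sub_sq_le (sqrt_iter a (n + m)) (sqrt_iter a n).
have := it0 n; have := it0 (n + m)%N.
have := rnorm_ge0 (sqrt_iter a n); have := rnorm_ge0 (sqrt_iter a (n + m)).
have := rnorm_ge0 (sqrt_iter a (n + m) - sqrt_iter a n).
by nra.
Qed.

Lemma sqrt_iter_cvg a : rnorm a <= 1 ->
  exists y, [/\ rcvg (sqrt_iter a) y, rnorm y <= 1 &
    (1c - y) ** (1c - y) = 1c - a].
Proof.
move=> a1.
have it1 n : rnorm (sqrt_iter a n) <= 1.
  have := sqrt_iter_dist 0 n a1; rewrite !subr0.
  by have /andP[_] := sqrt_majorant_bounds n; rewrite add0n; lra.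
have tail n m : (n <= m)%N ->
    rnorm (sqrt_iter a m - sqrt_iter a n) <= 2 / n.+2%:R.
  move=> /subnKC <-; have := sqrt_iter_dist n (m - n) a1.
  have /andP[] := sqrt_majorant_bounds n; set d := 2 / _ => d1 _.
  by have /andP[_] := sqrt_majorant_bounds (n + (m - n)); lra.
have small (e : R) : 0 < e -> exists N, 2 / N.+2%:R < e.
  move=> e0; exists (Num.bound (2 / e)).
  rewrite ltr_pdivrMr ?ltr0n// mulrC -ltr_pdivrMr//.
  apply: lt_trans (archi_boundP _) _; first by rewrite divr_ge0// ltW.
  by rewrite ltr_nat.
have [y uy] : exists y, rcvg (sqrt_iter a) y.
  apply: rcauchy_cvg => e e0.
  have [|N HN] := small (e / 2); first by lra.
  exists N => m n Nm Nn.
  have := rnormB (sqrt_iter a m - sqrt_iter a N) (sqrt_iter a n - sqrt_iter a N).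
  rewrite opprB addrA subrK.
  move: HN (tail _ _ Nm) (tail _ _ Nn); set d := 2 / _; lra.
have y1 : rnorm y <= 1 by apply: rcvg_rnorm_le uy.
exists y; split => //.
(* The limit is a fixed point: compare [y] with two consecutive iterates. *)
have yE : y - (2^-1)%:C *: (a + y ** y) = 0.
  apply: rnorm_lt_eq0 => e e0.
  have [|N HN] := uy (e / 2); first by lra.
  have := HN N (leqnn _); have := HN N.+1 (leqnSn _); rewrite /= => H1 H2.
  have -> : y - (2^-1)%:C *: (a + y ** y) =
     (2^-1)%:C *: (sqrt_iter a N ** sqrt_iter a N - y ** y) -
      ((2^-1)%:C *: (a + sqrt_iter a N ** sqrt_iter a N) - y).
    by linear_identity R[i].
  have := rnormB ((2^-1)%:C *: (sqrt_iter a N ** sqrt_iter a N - y ** y))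
    ((2^-1)%:C *: (a + sqrt_iter a N ** sqrt_iter a N) - y).
  rewrite rnormZr ?invr_ge0//.
  have := rnorm_sub_sq_le (sqrt_iter a N) y; have := it1 N.
  by have := rnorm_ge0 (sqrt_iter a N - y); nra.
(* The residual is inserted so that [yE] turns [a] into 2y - y^2. *)
have -> : a = 2%:C *: (y - (y - (2^-1)%:C *: (a + y ** y))) - y ** y.
  by linear_identity R[i].
rewrite yE !cmulE; linear_identity R[i].
Qed.

End SquareRoot.

(** * The cone of positive elements *)

Section Positivity.
Variables (R : realType) (A : completeNormedModType R[i]) (cA : CStarAlgebra A).

Local Notation "x ** y" := (cmul cA x y) (at level 40, left associativity).
Local Notation "x ^†" := (cstar cA x) (at level 2, format "x ^†").
Local Notation "1c" := (cone cA).
Local Notation cself := (cself cA).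
Local Notation ccomm := (ccomm cA).
Implicit Types (x y z h k a : A) (t s : R).

Lemma cself1 : cself 1c. Proof. exact: cstar1. Qed.

Lemma cselfD x y : cself x -> cself y -> cself (x + y).
Proof. by rewrite /cself cstarD => -> ->. Qed.

Lemma cselfB x y : cself x -> cself y -> cself (x - y).
Proof. by rewrite /cself cstarB => -> ->. Qed.

Lemma cselfN x : cself x -> cself (- x).
Proof. by rewrite /cself cstarN => ->. Qed.

Lemma cselfZ t x : cself x -> cself (t%:C *: x).
Proof. by rewrite /cself cstarZr => ->. Qed.

Lemma cselfM x y : cself x -> cself y -> ccomm x y -> cself (x ** y).
Proof. by rewrite /cself cstarM => -> ->. Qed.

Lemma cself_sq x : cself x -> cself (x ** x).
Proof. by rewrite /cself cstarM => ->. Qed.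

Lemma cself_starM x : cself (x^† ** x).
Proof. by rewrite /cself cstarM cstarK. Qed.

(** The iteration is run at a = 1 - x. Its iterates are real polynomials in [x], so the root
    inherits self-adjointness and commutation. The limit itself is kept in the conclusion because it
    also yields invariance of the root under automorphisms fixing [x]. *)
Lemma sqrt_near1 x : cself x -> rnorm (1c - x) <= 1 ->
  exists k, [/\ cself k, k ** k = x, rnorm (1c - k) <= 1,
    (forall z, ccomm z x -> ccomm z k) &
    rcvg (sqrt_iter cA (1c - x)) (1c - k)].
Proof.
move=> xs /(@sqrt_iter_cvg _ _ cA)[y [uy y1 yE]]; exists (1c - y); split.
- apply: cselfB; first exact: cself1.
  apply: rcvg_cself uy => n; elim: n => [|n IH] /=; first exact: cstar0.
  by apply/cselfZ/cselfD; [exact: cselfB cself1 xs|exact: cself_sq].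
- by rewrite yE; linear_identity R[i].
- by rewrite subKr.
- move=> z zx; apply: ccommB; first exact: ccomm1.
  apply: rcvg_ccomm uy => n; elim: n => [|n IH] /=.
    by rewrite /ccomm !cmulE.
  apply/ccommZ/ccommD; last exact: ccommM.
  by apply: ccommB => //; exact: ccomm1.
- by rewrite subKr.
Qed.

(** * Contractivity of automorphisms *)

Section Automorphism.
Variables (alpha : A -> A) (autA : is_automorphism cA alpha).

Lemma autD x y : alpha (x + y) = alpha x + alpha y.
Proof. by case: autA => _ []. Qed.
Lemma autZ (c : R[i]) x : alpha (c *: x) = c *: alpha x.
Proof. by case: autA => _ [_ []]. Qed.
Lemma autM x y : alpha (x ** y) = alpha x ** alpha y.
Proof. by case: autA => _ [_ [_ []]]. Qed.
Lemma aut1 : alpha 1c = 1c.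
Proof. by case: autA => _ [_ [_ [_ []]]]. Qed.
Lemma aut_star x : alpha x^† = (alpha x)^†.
Proof. by case: autA => _ [_ [_ [_ []]]]. Qed.
Lemma autN x : alpha (- x) = - alpha x.
Proof. by rewrite -scaleN1r autZ scaleN1r. Qed.
Lemma autB x y : alpha (x - y) = alpha x - alpha y.
Proof. by rewrite autD autN. Qed.
Lemma aut0 : alpha 0 = 0.
Proof. by apply: (@addIr _ (alpha 0)); rewrite -autD !add0r. Qed.

Lemma aut_self x : cself x -> cself (alpha x).
Proof. by rewrite /cself -aut_star => ->. Qed.

(** With k^2 = 1 - h^2, the images of h and k still commute and have squares summing to 1, so
    [rnorm_circle_le1] applies to them. The argument is algebraic and presupposes no continuity of
    [alpha]. *)
Lemma aut_self_le1 h : cself h -> rnorm h <= 1 -> rnorm (alpha h) <= 1.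
Proof.
move=> hs h1; have [||k [ks kk _ kc _]] := @sqrt_near1 (1c - h ** h).
- exact: cselfB cself1 (cself_sq hs).
- rewrite subKr rnorm_self_sq//.
  by have := rnorm_ge0 h; nra.
have hk : ccomm h k.
  by apply: kc; apply: ccommB; [exact: ccomm1|exact: ccommM].
apply: (@rnorm_circle_le1 _ _ cA _ (alpha k)); try exact: aut_self.
  by rewrite /ccomm -!autM hk.
by rewrite -!autM -autD kk addrC subrK aut1.
Qed.

(** The self-adjoint case follows by scaling; applied to x^† x, it gives the general case through
    the C*-identity. *)
Lemma rnorm_aut x : rnorm (alpha x) <= rnorm x.
Proof.
suff le_self h : cself h -> rnorm (alpha h) <= rnorm h.
  have := le_self _ (cself_starM x); rewrite autM aut_star !rnorm_starM.
  by rewrite ler_sqr ?nnegrE ?rnorm_ge0.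
move=> hs; have [h0|hn0] := eqVneq (rnorm h) 0.
  by rewrite (rnorm_eq0 h0) aut0.
have h0 : 0 < rnorm h by rewrite lt_neqAle eq_sym hn0 rnorm_ge0.
have := @aut_self_le1 ((rnorm h)^-1%:C *: h) (cselfZ _ hs).
rewrite autZ !rnormZr ?invr_ge0 ?rnorm_ge0// mulVf// lexx => /(_ isT).
by rewrite mulrC ler_pdivrMr ?mul1r.
Qed.

End Automorphism.

Definition cpos x := exists2 k, cself k & x = k ** k.

Lemma cpos_self x : cpos x -> cself x.
Proof. by case=> k ks ->; exact: cself_sq. Qed.

Lemma cpos_sq k : cself k -> cpos (k ** k).
Proof. by move=> ks; exists k. Qed.

Lemma cpos0 : cpos 0.
Proof. by exists 0; rewrite ?cmul0l//; exact: cstar0. Qed.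

Lemma cposZ t x : 0 <= t -> cpos x -> cpos (t%:C *: x).
Proof.
move=> t0 [k ks ->]; exists ((Num.sqrt t)%:C *: k); first exact: cselfZ.
by rewrite !cmulE scalerA -rmorphM /= -expr2 sqr_sqrtr.
Qed.

Lemma scaleVcK t x : 0 < t -> t%:C *: ((t^-1)%:C *: x) = x.
Proof. by move=> t0; rewrite scalerA -rmorphM /= mulfV ?gt_eqF// scale1r. Qed.

Lemma cposZ_inv t x : 0 < t -> cpos ((t^-1)%:C *: x) -> cpos x.
Proof. by move=> t0 /(cposZ (ltW t0)); rewrite scaleVcK. Qed.

Lemma cpos1 t : 0 <= t -> cpos (t%:C *: 1c).
Proof. by move=> t0; apply: cposZ => //; exists 1c; rewrite ?cmul1l//; exact: cself1. Qed.

Lemma cpos_near1 x : cself x -> rnorm (1c - x) <= 1 -> cpos x.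
Proof. by move=> xs /(sqrt_near1 xs)[k [ks kk _ _ _]]; exists k. Qed.

(** Converse of [cpos_near1] on the unit ball. If x = h^2 and k^2 = 1 - h^2, the circle lemma gives
    |k| <= 1, hence |1 - x| = |k|^2 <= 1. *)
Lemma near1_cpos x : cpos x -> rnorm x <= 1 -> rnorm (1c - x) <= 1.
Proof.
move=> [h hs ->] h1; have [||k [ks kk _ kc _]] := @sqrt_near1 (1c - h ** h).
- exact: cselfB cself1 (cself_sq hs).
- by rewrite subKr.
have hk : ccomm h k.
  by apply: kc; apply: ccommB; [exact: ccomm1|exact: ccommM].
have := @rnorm_circle_le1 _ _ cA _ h ks hs (ccomm_sym hk).
rewrite {1}kk subrK -kk rnorm_self_sq// => /(_ erefl).
by have := rnorm_ge0 k; nra.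
Qed.

(** After rescaling into the unit ball, positivity reads |1 - x| <= 1, a convex condition, so it
    passes to midpoints. *)
Lemma cposD x y : cpos x -> cpos y -> cpos (x + y).
Proof.
move=> xp yp; pose t := rnorm x + rnorm y + 1.
have x0 := rnorm_ge0 x; have y0 := rnorm_ge0 y.
have t0 : 0 < t by rewrite /t; lra.
have t20 : 0 < t * 2 by rewrite /t; lra.
have tV0 : 0 <= t^-1 by rewrite invr_ge0 ltW.
apply: (cposZ_inv t20); apply: cpos_near1.
  by apply/cselfZ/cselfD; exact: cpos_self.
have -> : 1c - ((t * 2)^-1)%:C *: (x + y) =
   (2^-1)%:C *: ((1c - (t^-1)%:C *: x) + (1c - (t^-1)%:C *: y)).
  by rewrite invfM rmorphM /=; move: (t^-1) => s; linear_identity R[i].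
have nx z : cpos z -> rnorm z <= t -> rnorm (1c - (t^-1)%:C *: z) <= 1.
  move=> zp zt; apply: near1_cpos; first exact: cposZ.
  by rewrite rnormZr// mulrC ler_pdivrMr ?mul1r.
rewrite rnormZr ?invr_ge0//.
have := rnormD (1c - (t^-1)%:C *: x) (1c - (t^-1)%:C *: y).
have := nx _ xp; have := nx _ yp; rewrite /t => h1 h2.
have {}h1 := h1 ltac:(lra); have {}h2 := h2 ltac:(lra).
lra.
Qed.

Lemma cpos_sub_le x t : cself x -> rnorm x <= t -> cpos (t%:C *: 1c - x).
Proof.
move=> xs xt; have := rnorm_ge0 x; rewrite le_eqVlt => /predU1P[x0|x0].
  by rewrite (rnorm_eq0 (esym x0)) subr0; apply: cpos1; lra.
have t0 : 0 < t by lra.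
apply: (cposZ_inv t0); apply: cpos_near1.
  by apply/cselfZ/cselfB => //; apply: cselfZ; exact: cself1.
have -> : 1c - (t^-1)%:C *: (t%:C *: 1c - x) = (t^-1)%:C *: x.
  by rewrite scalerBr scalerA -rmorphM /= mulVf ?gt_eqF// scale1r subKr.
by rewrite rnormZr ?invr_ge0 ?(ltW t0)// mulrC ler_pdivrMr ?mul1r.
Qed.

(** The last clause lets a positive fixed element be written as k^† k with k itself fixed;
    positivity of functionals on the fixed-point algebra is tested on exactly such products. *)
Lemma cpos_sqrt x : cpos x -> exists k, [/\ cself k, cpos k, k ** k = x,
  (forall z, ccomm z x -> ccomm z k) &
  (forall alpha, is_automorphism cA alpha -> alpha x = x -> alpha k = k)].
Proof.
move=> xp; pose t := rnorm x + 1.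
have t0 : 0 < t by have := rnorm_ge0 x; rewrite /t; lra.
have [||k [ks kk k1 kc ku]] := @sqrt_near1 ((t^-1)%:C *: x).
- by apply: cselfZ; exact: cpos_self.
- apply: near1_cpos; first by apply: cposZ; rewrite // invr_ge0 ltW.
  by rewrite rnormZr ?invr_ge0 ?(ltW t0)// mulrC ler_pdivrMr// /t; lra.
exists ((Num.sqrt t)%:C *: k); split.
- exact: cselfZ.
- by apply: cposZ; rewrite ?sqrtr_ge0//; exact: cpos_near1.
- by rewrite !cmulE scalerA -rmorphM /= -expr2 sqr_sqrtr ?ltW// kk scaleVcK.
- by move=> z zx; apply/ccommZ/kc/ccommZ.
move=> alpha autA ax; rewrite (autZ autA); congr (_ *: _).
have fix_iter n : alpha (sqrt_iter cA (1c - (t^-1)%:C *: x) n) =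
    sqrt_iter cA (1c - (t^-1)%:C *: x) n.
  elim: n => [|n IH] /=; first exact: (aut0 autA).
  by rewrite (autZ autA) (autD autA) (autB autA) (aut1 autA) (autZ autA) ax
    (autM autA) IH.
suff : alpha (1c - k) - (1c - k) = 0.
  rewrite (autB autA) (aut1 autA) => /eqP; rewrite subr_eq0 => /eqP.
  by move=> /addrI/oppr_inj.
apply: (@rcvg_lipschitz0 _ _ (fun z => alpha z - z) 2) ku => [y z|n]; last first.
  by rewrite fix_iter subrr.
have -> : alpha y - y - (alpha z - z) = alpha (y - z) - (y - z).
  by rewrite (autB autA); linear_identity R[i].
by have := rnormB (alpha (y - z)) (y - z); have := rnorm_aut autA (y - z); lra.
Qed.

(** Two uses of the commutation clause of [cpos_sqrt] make the roots commute, so xy = (kr)^2. *)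
Lemma cposM_comm x y : cpos x -> cpos y -> ccomm x y -> cpos (x ** y).
Proof.
move=> /cpos_sqrt[k [ks _ kk kc _]] /cpos_sqrt[r [rs _ rr rc _]] xy.
have kr : ccomm k r by apply/rc/ccomm_sym/kc/ccomm_sym.
exists (k ** r); first exact: cselfM.
by rewrite -kk -rr -!cmulA (cmulA cA k r r) kr -(cmulA cA r k r) kr.
Qed.

(** For t > 0, square roots of x/t and 1 - x/t commute and lie on the circle, which bounds the norm
    of the first one by 1. The case t = 0 is reached through t + e. *)
Lemma cpos_le_norm x t : 0 <= t -> cpos x -> cpos (t%:C *: 1c - x) -> rnorm x <= t.
Proof.
suff H s : 0 < s -> cpos x -> cpos (s%:C *: 1c - x) -> rnorm x <= s.
  move=> t0 xp tx; apply/ler_addgt0Pr => e e0; apply: H => //; first lra.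
  rewrite rmorphD /= scalerDl addrAC; apply: cposD => //.
  by apply: cpos1; exact: ltW.
move=> s0 xp sx; have sV : 0 <= s^-1 by rewrite invr_ge0 ltW.
have sx' : cpos (1c - (s^-1)%:C *: x).
  by have := cposZ sV sx; rewrite scalerBr scalerA -rmorphM /= mulVf ?gt_eqF// scale1r.
have [r [rs _ rr rc _]] := cpos_sqrt (cposZ sV xp).
have [k [ks _ kk kc _]] := cpos_sqrt sx'.
have rk : ccomm r k.
  apply: kc; apply: ccommB; first exact: ccomm1.
  by rewrite -rr; apply: ccommM.
have := rnorm_circle_le1 rs ks rk; rewrite rr kk addrC subrK => /(_ erefl) r1.
suff : s^-1 * rnorm x <= 1 by rewrite mulrC ler_pdivrMr ?mul1r.
by rewrite -rnormZr// -rr rnorm_self_sq//; have := rnorm_ge0 r; nra.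
Qed.

Lemma cpos_scalar_ge0 t : cpos (t%:C *: 1c) -> 0 <= t.
Proof.
move=> tp; rewrite leNgt; apply/negP => t0.
have Nt0 : 0 <= - t by rewrite oppr_ge0 ltW.
have := cpos_le_norm (lexx 0) (cpos1 Nt0).
rewrite rnormZr// rnorm1 scale0r sub0r rmorphN scaleNr opprK => /(_ tp); lra.
Qed.

(** The two hypotheses concern commuting factors of t^2 - x^2, which is therefore positive. *)
Lemma cpos_abs_le_norm x t : cpos (t%:C *: 1c - x) ->
  cpos (t%:C *: 1c + x) -> rnorm x <= t.
Proof.
move=> m p.
have t0 : 0 <= t.
  apply: cpos_scalar_ge0.
  have -> : t%:C *: 1c = (2^-1)%:C *: ((t%:C *: 1c - x) + (t%:C *: 1c + x)).
    by linear_identity R[i].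
  by apply: cposZ; [rewrite invr_ge0|exact: cposD].
have xs : cself x.
  have -> : x = (2^-1)%:C *: ((t%:C *: 1c + x) - (t%:C *: 1c - x)).
    by linear_identity R[i].
  by apply/cselfZ/cselfB; exact: cpos_self.
have : cpos ((t ^+ 2)%:C *: 1c - x ** x).
  have -> : (t ^+ 2)%:C *: 1c - x ** x = (t%:C *: 1c - x) ** (t%:C *: 1c + x).
    by rewrite rmorphXn !cmulE; linear_identity R[i].
  apply: cposM_comm => //.
  by rewrite /ccomm !cmulE; linear_identity R[i].
move=> /(cpos_le_norm (sqr_ge0 t) (cpos_sq xs)).
by rewrite rnorm_self_sq// ler_sqr// nnegrE rnorm_ge0.
Qed.

(** The uniform bound permits a single rescaling, after which positivity is the closed condition |1
    - x| <= 1. *)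
Lemma rcvg_cpos (u : nat -> A) l C : (forall n, cpos (u n)) ->
  (forall n, rnorm (u n) <= C) -> rcvg u l -> cpos l.
Proof.
move=> up uC ul.
have C0 : 0 < C + 1 by have := uC 0%N; have := rnorm_ge0 (u 0%N); lra.
have CV : 0 <= (C + 1)^-1 by rewrite invr_ge0 ltW.
have ls : cself l by apply: rcvg_cself ul => n; exact: cpos_self.
apply: (cposZ_inv C0); apply: cpos_near1; first exact: cselfZ.
apply: (@rcvg_rnorm_le _ _ (fun n => 1c - ((C + 1)^-1)%:C *: u n)) => [n|e e0].
  apply: near1_cpos; first exact: cposZ.
  by rewrite rnormZr// mulrC ler_pdivrMr//; have := uC n; lra.
have [|N HN] := ul (e * (C + 1)); first by rewrite mulr_gt0.
exists N => n /HN.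
have -> : 1c - ((C + 1)^-1)%:C *: u n - (1c - ((C + 1)^-1)%:C *: l) =
   ((C + 1)^-1)%:C *: (l - u n).
  by move: ((C + 1)^-1) => s; linear_identity R[i].
by rewrite rnormZr// ltr_pdivrMl// rnormBC mulrC.
Qed.

End Positivity.

(** * Positivity of b^† b *)

Section KelleyVaught.
Variables (R : realType) (A : completeNormedModType R[i]) (cA : CStarAlgebra A).

Local Notation "x ** y" := (cmul cA x y) (at level 40, left associativity).
Local Notation "x ^†" := (cstar cA x) (at level 2, format "x ^†").
Local Notation "1c" := (cone cA).
Local Notation cself := (cself cA).
Local Notation ccomm := (ccomm cA).
Local Notation cpos := (cpos cA).
Implicit Types (x y z h k a b c : A) (t s : R).

(** With u = c + c^† and v = i(c - c^†), both self-adjoint, u^2 + v^2 = 2(c c^† + c^† c). *)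
Lemma cpos_mul_star c : cpos (- (c^† ** c)) -> cpos (c ** c^†).
Proof.
move=> pp; pose u := c + c^†; pose v := 'i *: (c - c^†).
have us : cself u by rewrite /cself cstarD cstarK addrC.
have vs : cself v.
  rewrite /cself cstarZ cstarB cstarK /v.
  have -> : Num.conj ('i : R[i]) = - 'i by exact: conjCi.
  by rewrite scaleNr -scalerN opprB.
have -> : c ** c^† = (2^-1)%:C *: (u ** u + v ** v) + - (c^† ** c).
  have -> : v ** v = - ((c - c^†) ** (c - c^†)).
    by rewrite /v cmulZl cmulZr scalerA -expr2 sqrCi scaleN1r.
  by rewrite /u !cmulE; linear_identity R[i].
by apply: cposD => //; apply: cposZ; rewrite ?invr_ge0//; apply: cposD; exact: cpos_sq.
Qed.

(* With p = -c^†c and q = cc^†, both positive, c(s + p) = (s - q)c gives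
   |p(s + p)^2| <= s^2 |p|, which is impossible unless p = 0. *)
Lemma cpos_opp_starM c : cpos (- (c^† ** c)) -> c = 0.
Proof.
move=> pp; have qp := cpos_mul_star pp.
set p := - (c^† ** c) in pp; set q := c ** c^† in qp.
pose s := rnorm q + 1; have s0 : 0 < s by rewrite /s; have := rnorm_ge0 q; lra.
have sq : rnorm (s%:C *: 1c - q) <= s.
  apply: (@cpos_le_norm _ _ cA _ _ (ltW s0)); last by rewrite subKr.
  by apply: cpos_sub_le; [exact: cpos_self|rewrite /s; lra].
pose l := rnorm p; have l0 : 0 <= l := rnorm_ge0 p.
have lE : l = rnorm c ^+ 2 by rewrite /l rnormN rnorm_starM.
have ps := cpos_self pp.
pose w := s%:C *: 1c + p.
have ws : cself w by apply: cselfD => //; apply: cselfZ; exact: cself1.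
have cw : c ** w = (s%:C *: 1c - q) ** c.
  by rewrite /w /q /p !cmulE cmulA.
pose z := w ** p ** w.
have zE : z = - ((c ** w)^† ** (c ** w)).
  by rewrite cstarM ws /z /p !cmulE -!cmulA.
have zs : cself z by rewrite zE; apply: cselfN; exact: cself_starM.
have zn : rnorm z <= s ^+ 2 * l.
  rewrite zE rnormN rnorm_starM lE -exprMn ler_sqr ?nnegrE ?rnorm_ge0//; last first.
    by rewrite mulr_ge0 ?rnorm_ge0// ltW.
  rewrite cw; have := rnormM cA (s%:C *: 1c - q) c.
  by have := rnorm_ge0 c; nra.
have ppp : cpos (p ** (p ** p)).
  by apply: cposM_comm => //; [exact: cpos_sq|rewrite /ccomm cmulA].
pose d := p - l%:C *: 1c.
have ds : cself d by apply: cselfB => //; apply: cselfZ; exact: cself1.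
(* Since z = s^2 p + 2s p^2 + p^3, adding p^3 and 2s(p - l)^2 to s^2 l - z cancels the powers of p
   above the first and leaves t - C p. The resulting bound C l <= t says 2s l^2 <= 0. *)
pose C := s ^+ 2 + 4 * s * l; pose t := l * (s ^+ 2 + 2 * s * l).
have sl0 : 0 <= s * l by rewrite mulr_ge0// ltW.
have C0 : 0 <= C by rewrite /C; nra.
have t0 : 0 <= t by rewrite /t mulr_ge0//; nra.
have : cpos (t%:C *: 1c - C%:C *: p).
  have -> : t%:C *: 1c - C%:C *: p =
     ((s ^+ 2 * l)%:C *: 1c - z) + p ** (p ** p) + (2 * s)%:C *: (d ** d).
    rewrite /t /C /z /d /w; move: (p) (l) => e r.
    by rewrite !cmulE -!cmulA; linear_identity R[i].
  apply: cposD; first apply: cposD => //; first exact: cpos_sub_le.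
  by apply: cposZ; [lra|exact: cpos_sq].
move=> /(cpos_le_norm t0 (cposZ C0 pp)).
rewrite rnormZr// -/l /C /t => ineq.
have /eqP : l ^+ 2 = 0 by have := sqr_ge0 l; nra.
by rewrite sqrf_eq0 lE sqrf_eq0 => /eqP/rnorm_eq0.
Qed.

(** Here k plays the role of |h|, and m = k - h that of twice the negative part of h. As mh = -mk,
    the element (bm)^† (bm) = -k m^2 has positive opposite, so bm = 0. This gives k m^2 = 0, then
    m^3 = 0, and finally m = 0, that is h = k. *)
Theorem cpos_starM b : cpos (b^† ** b).
Proof.
set h := b^† ** b; have hs : cself h by exact: cself_starM.
have [k [ks kp kk kc _]] := cpos_sqrt (cpos_sq hs).
have hk : ccomm h k by apply: kc; exact: ccommM.
pose m := k - h; have ms : cself m by exact: cselfB.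
have km : ccomm k m by apply: ccommB => //; exact: ccomm_sym.
have mh : m ** h = - (m ** k).
  rewrite /m !cmulE kk hk; linear_identity R[i].
have cc : (b ** m)^† ** (b ** m) = - (k ** (m ** m)).
  rewrite cstarM ms -cmulA (cmulA cA b^†) -/h cmulA mh cmulNl.
  by rewrite -km cmulA.
have bm0 : b ** m = 0.
  apply: cpos_opp_starM; rewrite cc opprK; apply: cposM_comm => //.
    exact: cpos_sq.
  exact: ccommM.
have kmm : k ** (m ** m) = 0.
  by apply: oppr_inj; rewrite -cc bm0 cmul0r oppr0.
have mmm : m ** m ** m = 0.
  have -> : m ** m ** m = m ** k ** m - m ** h ** m by rewrite -cmulBl -cmulBr.
  by rewrite mh -km cmulNl -cmulA kmm oppr0 subr0.
have m0 : m = 0.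
  have := rnorm_self_sq (cself_sq ms); rewrite cmulA mmm cmul0l rnorm0.
  rewrite rnorm_self_sq// => /esym/eqP; rewrite !sqrf_eq0 => /eqP.
  exact: rnorm_eq0.
by have <- : k = h by apply/eqP; rewrite -subr_eq0 -/m m0.
Qed.

End KelleyVaught.

(** * Extension of positive functionals *)

(* M. Riesz extension theorem.  The partial functional to be extended is given
   by its graph; positivity makes the graph single-valued. *)
Section RieszExtension.
Variables (R : realType) (V : lmodType R[i]) (K : set V).
Hypotheses (K0 : K 0) (KD : forall v w, K v -> K w -> K (v + w)).
Hypothesis KZ : forall (t : R) v, 0 <= t -> K v -> K (t%:C *: v).
Implicit Types (G : set (V * R)) (v w : V) (r s t : R).

(** Only real scalars act: [V] is treated as a real vector space. *)
Definition graph_subspace G :=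
  G (0, 0) /\ forall t v r w s, G (v, r) -> G (w, s) -> G (t%:C *: v + w, t * r + s).

Definition graph_pos G := forall v r, G (v, r) -> K v -> 0 <= r.

Lemma graph_add G v r w s : graph_subspace G ->
  G (v, r) -> G (w, s) -> G (v + w, r + s).
Proof. by move=> [_ GZ] Gv /(GZ 1 _ _ _ _ Gv); rewrite scale1r mul1r. Qed.

Lemma graph_scale G t v r : graph_subspace G -> G (v, r) -> G (t%:C *: v, t * r).
Proof. by move=> [G0 GZ] Gv; have := GZ t _ _ _ _ Gv G0; rewrite !addr0. Qed.

Lemma graph_opp G v r : graph_subspace G -> G (v, r) -> G (- v, - r).
Proof. by move=> Gs /(graph_scale (-1) Gs); rewrite rmorphN1 scaleN1r mulN1r. Qed.

Lemma graph_fun G v r s : graph_subspace G -> graph_pos G ->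
  G (v, r) -> G (v, s) -> r = s.
Proof.
move=> Gs Gp; suff le r' s' : G (v, r') -> G (v, s') -> r' <= s'.
  by move=> Gr Gt; apply: le_anti; rewrite !le.
move=> Gr Gt; have := graph_add Gs Gt (graph_opp Gs Gr).
by rewrite subrr => /Gp /(_ K0); rewrite subr_ge0.
Qed.

Variables (e : V).
Hypothesis Ke : forall v, exists t, K (t%:C *: e - v).

(** The value at [v] is the supremum of the values taken below [v] on the domain; since [e] is an
    order unit, this set is nonempty and bounded above. Positivity at d + tv reduces, after division
    by |t|, to comparing [v] with an element of the domain. *)
Lemma graph_extend G c v : graph_subspace G -> graph_pos G -> G (e, c) ->
  exists G', [/\ graph_subspace G', graph_pos G', G `<=` G' & exists a, G' (v, a)].
Proof.
move=> Gs Gp Ge; have [G0 GZ] := Gs.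
pose L : set R := [set r | exists2 d, G (d, r) & K (v - d)].
have Lub d r : G (d, r) -> K (d - v) -> ubound L r.
  move=> Gd Kd l [d' Gd' Kd']; rewrite -subr_ge0.
  apply: (Gp (d - d')); first exact: graph_add Gs Gd (graph_opp Gs Gd').
  by have := KD Kd Kd'; rewrite addrA subrK.
have Lsup : has_sup L.
  split.
    have [t] := Ke (- v); rewrite opprK => Kt; exists (- (t * c)).
    exists (- (t%:C *: e)); last by rewrite opprK addrC.
    exact: graph_opp Gs (graph_scale _ Gs _).
  have [t Kt] := Ke v; exists (t * c); apply: Lub Kt; exact: graph_scale.
pose a := sup L.
have aL r : L r -> r <= a by move=> Lr; apply: ub_le_sup => //; case: Lsup.
have aU d r : G (d, r) -> K (d - v) -> a <= r.
  by move=> Gd /(Lub _ _ Gd) ub; apply: ge_sup => //; case: Lsup.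
exists [set p | exists d r t, G (d, r) /\ p = (d + t%:C *: v, r + t * a)]; split.
- split; first by exists 0, 0, 0; rewrite scale0r mul0r !addr0.
  move=> t _ _ _ _ [d [r [s [Gd [-> ->]]]]] [d' [r' [s' [Gd' [-> ->]]]]].
  exists (t%:C *: d + d'), (t * r + r'), (t * s + s'); split; first exact: GZ.
  congr (_, _); last by ring.
  by rewrite rmorphD rmorphM; linear_identity R[i].
- move=> w q [d [r [t [Gd [-> ->]]]]] Kw.
  have [t0|t0|t0] := ltgtP t 0.
  + have Nt0 : 0 < - t by rewrite oppr_gt0.
    have : a <= (- t)^-1 * r.
      apply: (aU ((- t)^-1%:C *: d)); first exact: graph_scale.
      have := @KZ (- t)^-1 _ _ Kw; rewrite invr_ge0 => /(_ (ltW Nt0)).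
      rewrite scalerDr scalerA -rmorphM /= invrN mulNr mulVf ?lt_eqF//.
      by rewrite rmorphN1 scaleN1r.
    by rewrite ler_pdivlMl// => ineq; lra.
  + have : - (t^-1 * r) <= a.
      apply: aL; exists (- (t^-1%:C *: d)); first exact: graph_opp Gs (graph_scale _ Gs _).
      have := @KZ t^-1 _ _ Kw; rewrite invr_ge0 => /(_ (ltW t0)).
      rewrite scalerDr scalerA -rmorphM /= mulVf ?gt_eqF// scale1r.
      by rewrite opprK addrC.
    by rewrite lerNl ler_pdivlMl// => ineq; lra.
  + move: Kw; rewrite t0 scale0r mul0r !addr0; exact: Gp.
- by move=> [d r] Gd; exists d, r, 0; rewrite scale0r mul0r !addr0.
- by exists a, 0, 0, 1; rewrite scale1r mul1r !add0r.
Qed.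

Theorem riesz_extension G0 c : graph_subspace G0 -> graph_pos G0 -> G0 (e, c) ->
  exists F : V -> R, [/\ forall t v w, F (t%:C *: v + w) = t * F v + F w,
    forall v, K v -> 0 <= F v & forall v r, G0 (v, r) -> F v = r].
Proof.
move=> G0s G0p G0e.
(* Zorn's lemma also tests the empty chain, whose union is empty; adjoining [G0] inside the property
   makes it hold there too. *)
pose P (X : set (V * R)) := graph_subspace (X `|` G0) /\ graph_pos (X `|` G0).
have [|X [[Gs Gp] Xmax]] := @Zorn_bigcup _ P.
  move=> F FP Ftot; split.
    split; first by right; case: G0s.
    have GZ X t v r w s : F X -> (X `|` G0) (v, r) -> (X `|` G0) (w, s) ->
        (\bigcup_(X in F) X `|` G0) (t%:C *: v + w, t * r + s).
      move=> FX Xv Xw; have [[_ XZ] _] := FP _ FX.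
      by case: (XZ t _ _ _ _ Xv Xw); [left; exists X|right].
    move=> t v r w s [[X FX Xv]|G0v] [[Y FY Yw]|G0w].
    - have [XY|YX] := Ftot _ _ FX FY.
        by apply: (GZ Y) => //; left => //; exact: XY.
      by apply: (GZ X) => //; left => //; exact: YX.
    - by apply: (GZ X) => //; [left|right].
    - by apply: (GZ Y) => //; [right|left].
    - by right; case: G0s => _; apply.
  move=> v r [[X FX Xv]|]; last exact: G0p.
  by have [_ +] := FP _ FX; apply; left.
set G := X `|` G0 in Gs Gp.
have Ge : G (e, c) by right.
have total v : exists a, G (v, a).
  have [G' [G's G'p GG' [a G'a]]] := graph_extend v Gs Gp Ge.
  have G'0 : G' `|` G0 = G'.
    by apply/seteqP; split=> p; [case=> // Gp0; apply: GG'; right|left].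
  apply: contrapT => noG; apply: (Xmax G'); last by rewrite /P G'0.
  split; first by move=> p Xp; apply: GG'; left.
  by move=> /(_ _ G'a) Xa; apply: noG; exists a; left.
have [F FG] := choice total.
exists F; split=> [t v w|v Kv|v r G0v].
- by apply: (graph_fun Gs Gp (FG _)); case: Gs => _; apply.
- exact: Gp (FG v) Kv.
- by apply: (graph_fun Gs Gp (FG _)); right.
Qed.

End RieszExtension.

(** * Ergodic averages *)

Section ErgodicAverages.
Variables (R : realType) (A : completeNormedModType R[i]) (cA : CStarAlgebra A).

Local Notation "x ** y" := (cmul cA x y) (at level 40, left associativity).
Local Notation "x ^†" := (cstar cA x) (at level 2, format "x ^†").
Local Notation "1c" := (cone cA).
Local Notation cself := (cself cA).
Local Notation cpos := (cpos cA).
Variables (alpha : A -> A) (autA : is_automorphism cA alpha).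
Implicit Types (x y z a b w : A) (t : R).

Local Notation avg := (ergodic_avg alpha).
Local Notation fixa := (fixed_pts alpha).
Local Notation cob := (coboundaries alpha).

Let alphaD := autD autA.
Let alphaZ := autZ autA.
Let alphaB := autB autA.

Lemma iter_autD k x y : iter k alpha (x + y) = iter k alpha x + iter k alpha y.
Proof. by elim: k => //= k ->. Qed.

Lemma iter_autB k x y : iter k alpha (x - y) = iter k alpha x - iter k alpha y.
Proof. by elim: k => //= k ->. Qed.

Lemma iter_autZ k (c : R[i]) x : iter k alpha (c *: x) = c *: iter k alpha x.
Proof. by elim: k => //= k ->. Qed.

Lemma iter_fixed k b : fixa b -> iter k alpha b = b.
Proof. by move=> ab; elim: k => //= k ->. Qed.

Lemma rnorm_iter k x : rnorm (iter k alpha x) <= rnorm x.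
Proof. by elim: k => //= k; apply: le_trans; exact: rnorm_aut autA _. Qed.

Lemma cpos_aut x : cpos x -> cpos (alpha x).
Proof.
by move=> [k ks ->]; rewrite (autM autA); apply/cpos_sq/(aut_self autA).
Qed.

Lemma cpos_iter k x : cpos x -> cpos (iter k alpha x).
Proof. by move=> xp; elim: k => //= k; exact: cpos_aut. Qed.

Lemma natVc n : (n%:R^-1 : R[i]) = (n%:R^-1 : R)%:C.
Proof. by rewrite fmorphV rmorph_nat. Qed.

Lemma avgD n x y : avg (x + y) n = avg x n + avg y n.
Proof.
by rewrite /ergodic_avg (eq_bigr _ (fun (k : 'I_n) _ => iter_autD k x y)) big_split scalerDr.
Qed.

Lemma avgZ n (c : R[i]) x : avg (c *: x) n = c *: avg x n.
Proof.
rewrite /ergodic_avg (eq_bigr _ (fun (k : 'I_n) _ => iter_autZ k c x)) -scaler_sumr.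
by rewrite !scalerA mulrC.
Qed.

Lemma avgN n x : avg (- x) n = - avg x n.
Proof. by rewrite -scaleN1r avgZ scaleN1r. Qed.

Lemma avgB n x y : avg (x - y) n = avg x n - avg y n.
Proof. by rewrite avgD avgN. Qed.

(** The index is a successor because the average of no terms is 0. *)
Lemma avg_fixed n b : fixa b -> avg b n.+1 = b.
Proof.
move=> ab; rewrite /ergodic_avg (eq_bigr (fun=> b)) => [|k _]; last exact: iter_fixed.
by rewrite sumr_const card_ord -[b *+ _]scaler_nat scalerA mulVf ?scale1r ?pnatr_eq0.
Qed.

Lemma rnorm_avg n x : rnorm (avg x n) <= rnorm x.
Proof.
case: n => [|n]; first by rewrite /ergodic_avg big_ord0 scaler0 rnorm0 rnorm_ge0.
rewrite /ergodic_avg natVc rnormZr ?invr_ge0// ler_pdivrMl ?ltr0n//.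
elim: n.+1 => [|m IH]; first by rewrite big_ord0 rnorm0 mul0r.
rewrite big_ord_recr /= -natr1 mulrDl mul1r.
apply: (le_trans (rnormD _ _)); apply: lerD => //; exact: rnorm_iter.
Qed.

Lemma cpos_avg n x : cpos x -> cpos (avg x n).
Proof.
move=> xp; rewrite /ergodic_avg natVc; apply: cposZ; first by rewrite invr_ge0.
elim: n => [|n IH]; first by rewrite big_ord0; exact: cpos0.
by rewrite big_ord_recr /=; apply: cposD => //; exact: cpos_iter.
Qed.

(** The sum telescopes. *)
Lemma avg_coboundary n x : avg (x - alpha x) n = n%:R^-1 *: (x - iter n alpha x).
Proof.
rewrite /ergodic_avg; congr (_ *: _).
elim: n => [|n IH]; first by rewrite big_ord0 subrr.
rewrite big_ord_recr /= IH iter_autB -iterSr /=.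
by linear_identity R[i].
Qed.

Lemma rnorm_avg_coboundary n x : rnorm (avg (x - alpha x) n) <= 2 * rnorm x / n%:R.
Proof.
rewrite avg_coboundary natVc rnormZr ?invr_ge0// mulrC ler_wpM2r ?invr_ge0//.
by have := rnormB x (iter n alpha x); have := rnorm_iter n x; lra.
Qed.

Lemma ltr_divn (C e : R) : 0 <= C -> 0 < e ->
  exists N, forall n, (N <= n)%N -> C / n.+1%:R < e.
Proof.
move=> C0 e0; exists (Num.bound (C / e)) => n Nn.
rewrite ltr_pdivrMr ?ltr0n// mulrC -ltr_pdivrMr//.
apply: lt_le_trans (archi_boundP _) _; first by rewrite divr_ge0// ltW.
by rewrite ler_nat (leq_trans Nn).
Qed.

Lemma rcvg_avg_coboundary w : cob w -> rcvg (avg w) 0.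
Proof.
move=> [x _ <-] e e0.
have [|N HN] := @ltr_divn (2 * rnorm x) e _ e0; first by rewrite mulr_ge0 ?rnorm_ge0.
exists N.+1 => -[//|n] Nn; rewrite subr0.
exact: le_lt_trans (rnorm_avg_coboundary _ _) (HN _ _).
Qed.

Lemma cob0 : cob 0.
Proof. by exists 0; rewrite // (aut0 autA) subrr. Qed.

Lemma cobD w z : cob w -> cob z -> cob (w + z).
Proof.
move=> [x _ <-] [y _ <-]; exists (x + y) => //.
by rewrite alphaD; linear_identity R[i].
Qed.

Lemma cobZ (c : R[i]) w : cob w -> cob (c *: w).
Proof. by move=> [x _ <-]; exists (c *: x); rewrite // alphaZ scalerBr. Qed.

Lemma cob_star w : cob w -> cob w^†.
Proof. by move=> [x _ <-]; exists x^†; rewrite // cstarB (aut_star autA). Qed.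

(** The difference is the mean of the elements x - alpha^k(x), each of which is a telescoping sum of
    coboundaries. *)
Lemma sub_avg_cob n x : cob (x - avg x n.+1).
Proof.
have xk k : cob (x - iter k alpha x).
  elim: k => [|k IH] /=; first by rewrite subrr; exact: cob0.
  have -> : x - alpha (iter k alpha x) =
     (x - iter k alpha x) + (iter k alpha x - alpha (iter k alpha x)).
    by linear_identity R[i].
  by apply: cobD => //; exists (iter k alpha x).
have -> : x - avg x n.+1 = n.+1%:R^-1 *: \sum_(k < n.+1) (x - iter k alpha x).
  rewrite sumrB scalerBr; congr (_ - _).
  by rewrite sumr_const card_ord -[x *+ _]scaler_nat scalerA mulVf ?scale1r ?pnatr_eq0.
apply: cobZ; elim: n.+1 => [|m IH]; first by rewrite big_ord0; exact: cob0.
by rewrite big_ord_recr /=; apply: cobD.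
Qed.

Lemma fixD x y : fixa x -> fixa y -> fixa (x + y).
Proof. by rewrite /fixed_pts /= alphaD => -> ->. Qed.

Lemma fixZ (c : R[i]) x : fixa x -> fixa (c *: x).
Proof. by rewrite /fixed_pts /= alphaZ => ->. Qed.

Lemma fix_star x : fixa x -> fixa x^†.
Proof. by rewrite /fixed_pts /= (aut_star autA) => ->. Qed.

Lemma fix1 : fixa 1c. Proof. exact: aut1 autA. Qed.

Definition fix_cob : set A := set_sum fixa cob.

Lemma fix_cobD x y : fix_cob x -> fix_cob y -> fix_cob (x + y).
Proof.
move=> [b [w [fb [cw ->]]]] [c [v [fc [cv ->]]]].
exists (b + c), (w + v); split; first exact: fixD.
by split; [exact: cobD|linear_identity R[i]].
Qed.

Lemma fix_cobZ (c : R[i]) x : fix_cob x -> fix_cob (c *: x).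
Proof.
move=> [b [w [fb [cw ->]]]]; exists (c *: b), (c *: w).
by split; [exact: fixZ|split; [exact: cobZ|rewrite scalerDr]].
Qed.

Lemma fix_cob_star x : fix_cob x -> fix_cob x^†.
Proof.
move=> [b [w [fb [cw ->]]]]; exists b^†, w^†.
by split; [exact: fix_star|split; [exact: cob_star|rewrite cstarD]].
Qed.

Lemma fix_cob_fix b : fixa b -> fix_cob b.
Proof. by move=> fb; exists b, 0; split => //; split; [exact: cob0|rewrite addr0]. Qed.

Lemma fix_cob_cob w : cob w -> fix_cob w.
Proof.
by move=> cw; exists 0, w; split; [exact: aut0 autA|split; rewrite ?add0r].
Qed.

End ErgodicAverages.

(** * Separation by invariant states *)

Section Complexification.
Variables (R : realType) (A : completeNormedModType R[i]) (cA : CStarAlgebra A).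

Local Notation "x ** y" := (cmul cA x y) (at level 40, left associativity).
Local Notation "x ^†" := (cstar cA x) (at level 2, format "x ^†").
Local Notation "1c" := (cone cA).
Local Notation cself := (cself cA).
Local Notation cpos := (cpos cA).
Implicit Types (x y z a b w : A) (t : R).

Lemma cstarZi x : ('i%C *: x)^† = - ('i%C *: x^†).
Proof.
by rewrite cstarZ -scaleNr; congr (_ *: _); rewrite complexiE; exact: conjCi.
Qed.

Variable f : A -> R.
Hypothesis fL : forall t x y, f (t%:C *: x + y) = t * f x + f y.
Hypothesis fpos : forall x, cpos (x + x^†) -> 0 <= f x.
Hypothesis f1 : f 1c = 1.

(** The complex-linear functional with real part [f]. *)
Definition complexify x : R[i] := f x +i* - f ('i%C *: x).

Lemma rlinD x y : f (x + y) = f x + f y.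
Proof. by have := fL 1 x y; rewrite scale1r mul1r. Qed.

Lemma rlin0 : f 0 = 0.
Proof. by apply: (@addIr _ (f 0)); rewrite -rlinD !add0r. Qed.

Lemma rlinZ t x : f (t%:C *: x) = t * f x.
Proof. by have := fL t x 0; rewrite addr0 rlin0 addr0. Qed.

Lemma rlinN x : f (- x) = - f x.
Proof. by have := rlinZ (-1) x; rewrite rmorphN1 scaleN1r mulN1r. Qed.

Lemma complexify_linear : linear_on setT complexify.
Proof.
split=> [x y _ _|c x _]; rewrite /complexify.
  by rewrite scalerDr !rlinD opprD.
case: c => a b; have cE z : (a +i* b) *: z = a%:C *: z + b%:C *: ('i%C *: z).
  rewrite scalerA -scalerDl; congr (_ *: _).
  by apply/eqP; rewrite eq_complex /= !(mulr0, mul0r, mulr1, addr0, add0r, subr0, oppr0) !eqxx.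
rewrite scalerA mulrC -scalerA !cE !fL !rlinZ scalerA -expr2 sqr_i scaleN1r rlinN.
by apply/eqP; rewrite eq_complex /=; apply/andP; split; apply/eqP; ring.
Qed.

(** A skew-adjoint element and its opposite both have real part 0. Stating [fpos] through x + x^†
    puts both in the cone where [f] is nonnegative. *)
Lemma rlin_skew x : x^† = - x -> f x = 0.
Proof.
move=> xs; apply: le_anti; apply/andP; split; last first.
  by apply: fpos; rewrite xs subrr; exact: cpos0.
by rewrite -oppr_ge0 -rlinN; apply: fpos; rewrite cstarN xs subrr; exact: cpos0.
Qed.

Lemma complexify_self x : cself x -> complexify x = (f x)%:C.
Proof.
by move=> xs; rewrite /complexify (@rlin_skew ('i%C *: x)) ?oppr0// cstarZi xs.
Qed.

Lemma rlin_le_norm x : f x <= rnorm x.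
Proof.
have : 0 <= f ((rnorm x)%:C *: 1c - x).
  apply: fpos; rewrite cstarB cstarZr cstar1.
  have -> : (rnorm x)%:C *: 1c - x + ((rnorm x)%:C *: 1c - x^†) =
      (2 * rnorm x)%:C *: 1c - (x + x^†) by linear_identity R[i].
  apply: cpos_sub_le; first by rewrite /cself cstarD cstarK addrC.
  by have := rnormD x x^†; rewrite rnorm_star; lra.
by rewrite rlinD rlinZ f1 rlinN mulr1 subr_ge0.
Qed.

Lemma complexify_state : state_on cA setT complexify.
Proof.
have gL := complexify_linear.
split; first exact: gL.
split.
  move=> b _; rewrite complexify_self; last exact: cself_starM.
  rewrite ler0c; apply: fpos; rewrite cself_starM; apply: cposD; exact: cpos_starM.
split=> [x _|e e0].
  have [->|z0] := eqVneq (complexify x) 0; first by rewrite normr0.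
  (* Multiplying by this phase makes the value real and nonnegative, so the bound on [f] applies. *)
  pose c := `|complexify x| / complexify x.
  have : complexify (c *: x) = `|complexify x|.
    by rewrite (proj2 gL)// /c divfK.
  move=> /(congr1 (@complex.Re R)) /= fc.
  have -> : `|complexify x| = (f (c *: x))%:C by rewrite fc.
  rewrite rnormE lecR; apply: (le_trans (rlin_le_norm _)).
  by rewrite rnormZ /c normrM normfV normr_id mulfV ?normr_eq0// mul1r.
exists 1c; split => //; split; first by rewrite rnormE rnorm1.
rewrite complexify_self; last exact: cstar1.
by rewrite f1 normr1 gtrDl oppr_lt0.
Qed.

End Complexification.

(** * Construction of two invariant states that agree on fixed points *)

Section Separation.
Variables (R : realType) (A : completeNormedModType R[i]) (cA : CStarAlgebra A).

Local Notation "x ** y" := (cmul cA x y) (at level 40, left associativity).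
Local Notation "x ^†" := (cstar cA x) (at level 2, format "x ^†").
Local Notation "1c" := (cone cA).
Local Notation cself := (cself cA).
Local Notation cpos := (cpos cA).
Variables (alpha : A -> A) (autA : is_automorphism cA alpha).
Implicit Types (x y z a b w : A) (t : R).

Local Notation avg := (ergodic_avg alpha).
Local Notation fixa := (fixed_pts alpha).
Local Notation cob := (coboundaries alpha).
Local Notation fix_cob := (fix_cob alpha).

(** If all self-adjoint elements were closer than d to the subspace, the real and imaginary parts of
    x would be, and recombining them would bring x itself within d. Homogeneity then introduces the
    factor l. *)
Lemma not_dense_self : closure fix_cob != setT ->
  exists x (d : R), [/\ cself x, 0 < d & forall (l : R) s, fix_cob s ->
    `|l| * d <= rnorm (l%:C *: x + s)].
Proof.
move=> /eqP nd; have [x xS] : exists x, ~ closure fix_cob x.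
  by apply: contrapT => H; apply: nd; apply/seteqP; split => // x _;
     apply: contrapT => xS; apply: H; exists x.
have [d d0 xd] : exists2 d, 0 < d & forall s, fix_cob s -> d <= rnorm (x - s).
  apply: contrapT => H; apply: xS; apply/rclosureP => e e0.
  apply: contrapT => He; apply: H; exists e => // s Ss.
  by rewrite leNgt; apply/negP => xs; apply: He; exists s.
have [y ys yd] : exists2 y, cself y & forall s, fix_cob s -> d <= rnorm (y - s).
  apply: contrapT => H.
  have near y : cself y -> exists2 s, fix_cob s & rnorm (y - s) < d.
    move=> ys; apply: contrapT => He; apply: H; exists y => // s Ss.
    by rewrite leNgt; apply/negP => xs; apply: He; exists s.
  have [|s Ss xs] := near (x + x^†).
    by rewrite /cself cstarD cstarK addrC.
  have [|r Sr xr] := near ('i%C *: (x^† - x)).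
    by rewrite /cself cstarZi cstarB cstarK -scalerN opprB.
  have Ssr : fix_cob ((2^-1)%:C *: s + (2^-1)%:C *: ('i%C *: r)).
    by apply: (fix_cobD autA); do !apply: (fix_cobZ autA).
  have := xd _ Ssr; apply/negP; rewrite -ltNge.
  have -> : x - ((2^-1)%:C *: s + (2^-1)%:C *: ('i%C *: r)) =
      (2^-1)%:C *: (((x + x^†) - s) + 'i%C *: ('i%C *: (x^† - x) - r)).
    have -> : 'i%C *: ('i%C *: (x^† - x) - r) = x - x^† - 'i%C *: r.
      by rewrite scalerBr scalerA -expr2 sqr_i scaleN1r opprB.
    by linear_identity R[i].
  rewrite rnormZr ?invr_ge0//.
  have := rnormD (x + x^† - s) ('i%C *: ('i%C *: (x^† - x) - r)).
  rewrite (rnormZ 'i%C) complexiE normCi mul1r. lra.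
exists y, d; split => // l s Ss; have [->|l0] := eqVneq l 0.
  by rewrite normr0 mul0r rnorm_ge0.
have -> : l%:C *: y + s = l%:C *: (y - (- l^-1)%:C *: s).
  rewrite rmorphN scaleNr opprK scalerDr scalerA -rmorphM /= mulfV// scale1r//.
rewrite rnormZ normcR /= ler_wpM2l// yd//; exact: fix_cobZ autA _ _ _.
Qed.

Lemma separating_states : closure fix_cob != setT ->
  exists g1 g2 : A -> R[i], [/\ state_on cA setT g1 /\ state_on cA setT g2,
    g1 1c = 1,
    (forall x, g1 (alpha x) = g1 x) /\ (forall x, g2 (alpha x) = g2 x),
    forall x, fixa x -> g1 x = g2 x & g1 <> g2].
Proof.
move=> /not_dense_self[x0 [d [x0s d0 dist]]].
pose K : set (A * A)%type := [set p | cpos (p.1 + p.1^†) /\ cpos (p.2 + p.2^†)].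
pose X (l : R) s : A := l%:C *: x0 + s.
(* Each parameter forces one property of the extension: pairs (s, -s) of value 0 make the two
   components agree on [fix_cob], the coboundaries w in the second slot make both components
   invariant, and the value d at (x0, -x0) separates them. As a relation, the functional needs no
   proof that the parameters determine the value. *)
pose G0 : set ((A * A) * R)%type := [set p | exists (l m : R) s w,
  [/\ fix_cob s, cob w &
   p = ((X l s + m%:C *: 1c, - X l s + w + m%:C *: 1c), l * d + m)]].
have K0 : K 0 by split; rewrite /= cstar0 addr0; exact: cpos0.
have KD (v w : A * A) : K v -> K w -> K (v + w).
  move=> [v1 v2] [w1 w2]; split; rewrite /= cstarD addrACA; exact: cposD.
have KZ (t : R) (v : A * A) : 0 <= t -> K v -> K (t%:C *: v).
  by move=> t0 [v1 v2]; split; rewrite /= cstarZr -scalerDr; exact: cposZ.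
pose e : (A * A)%type := (1c, 1c).
have Ke v : exists t : R, K (t%:C *: e - v).
  have aux y t : rnorm y <= t ->
      cpos (t%:C *: 1c - y + (t%:C *: 1c - y)^†).
    move=> yt; rewrite cstarB cstarZr cstar1.
    have -> : t%:C *: 1c - y + (t%:C *: 1c - y^†) =
      (2 * t)%:C *: 1c - (y + y^†) by linear_identity R[i].
    apply: cpos_sub_le; first by rewrite /cself cstarD cstarK addrC.
    by have := rnormD y y^†; rewrite rnorm_star; lra.
  exists (rnorm v.1 + rnorm v.2).
  by have := rnorm_ge0 v.1; have := rnorm_ge0 v.2; split; apply: aux; lra.
have S0 : fix_cob 0 by apply: (fix_cob_cob autA); exact: (cob0 autA).
have G0s : graph_subspace G0.
  split.
    exists 0, 0, 0, 0; split => //; first exact: (cob0 autA).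
    by rewrite /X !scale0r mul0r !addr0 oppr0.
  move=> t v r w s [l [m [s1 [w1 [S1 C1 [-> ->]]]]]] [l' [m' [s2 [w2 [S2 C2 [-> ->]]]]]].
  exists (t * l + l'), (t * m + m'), (t%:C *: s1 + s2), (t%:C *: w1 + w2); split.
  - by apply: (fix_cobD autA) => //; exact: (fix_cobZ autA).
  - by apply: (cobD autA) => //; exact: (cobZ autA).
  congr (_, _); last by ring.
  rewrite /X; congr (_, _); rewrite /= !(rmorphD, rmorphM) /=; linear_identity R[i].
have G0p : graph_pos K G0.
  move=> v r [l [m [s [w [Ss Cw [-> ->]]]]]] [/= k1 k2].
  suff lm : `|l| * d <= m.
    have := ler_norm (- l); rewrite normrN => ll.
    have : 0 <= (`|l| + l) * d by apply: mulr_ge0; lra.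
    by rewrite mulrDl; lra.
  (* The factor 2 comes from passing to y = X + X^†. Averaging makes the coboundary w' smaller than
     eps, so the two positivity conditions give |avg y| <= 2m + eps. Conversely, avg y differs from
     2l x0 by an element of [fix_cob], so its norm is at least 2|l| d. *)
  suff H (eps : R) : 0 < eps -> 2 * (`|l| * d) <= 2 * m + eps.
    suff : 2 * (`|l| * d) <= 2 * m by lra.
    by apply/ler_addgt0Pr => eps; exact: H.
  move=> eps0.
  pose y := X l s + (X l s)^†; pose w' := w + w^†.
  have Cw' : cob w' by apply: (cobD autA) => //; exact: (cob_star autA).
  have [N /(_ N.+1 (leqnSn N))] := rcvg_avg_coboundary autA Cw' eps0.
  rewrite subr0 => wN.
  have a1 : avg ((2 * m)%:C *: 1c) N.+1 = (2 * m)%:C *: 1c.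
    by apply/avg_fixed/(fixZ autA)/(fix1 autA).
  have p1 : cpos ((2 * m)%:C *: 1c + avg y N.+1).
    rewrite -a1 -(avgD autA); apply: (cpos_avg autA).
    have <- : X l s + m%:C *: 1c + (X l s + m%:C *: 1c)^† = (2 * m)%:C *: 1c + y.
      by rewrite cstarD cstarZr cstar1 /y; linear_identity R[i].
    exact: k1.
  have p2 : cpos ((2 * m)%:C *: 1c - avg y N.+1 + avg w' N.+1).
    rewrite -a1 -(avgB autA) -(avgD autA); apply: (cpos_avg autA).
    have <- : - X l s + w + m%:C *: 1c + (- X l s + w + m%:C *: 1c)^† =
        (2 * m)%:C *: 1c - y + w'.
      by rewrite !cstarD cstarN cstarZr cstar1 /y /w'; linear_identity R[i].
    exact: k2.
  have ws : cself (avg w' N.+1).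
    have -> : avg w' N.+1 = ((2 * m)%:C *: 1c - avg y N.+1 + avg w' N.+1)
       + ((2 * m)%:C *: 1c + avg y N.+1) - (4 * m)%:C *: 1c.
      by linear_identity R[i].
    apply: cselfB; last by apply: cselfZ; exact: cself1.
    by apply: cselfD; exact: cpos_self.
  have : rnorm (avg y N.+1) <= 2 * m + eps.
    apply: (@cpos_abs_le_norm _ _ cA).
      have -> : (2 * m + eps)%:C *: 1c - avg y N.+1 =
         ((2 * m)%:C *: 1c - avg y N.+1 + avg w' N.+1) +
         (eps%:C *: 1c - avg w' N.+1) by linear_identity R[i].
      by apply: cposD => //; apply: cpos_sub_le => //; exact: ltW.
    have -> : (2 * m + eps)%:C *: 1c + avg y N.+1 =
         ((2 * m)%:C *: 1c + avg y N.+1) + eps%:C *: 1c by linear_identity R[i].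
    by apply: cposD => //; apply: cpos1; exact: ltW.
  apply: le_trans.
  have -> : 2 * (`|l| * d) = `|2 * l| * d by rewrite normrM ger0_norm// mulrA.
  have yE : y = (2 * l)%:C *: x0 + (s + s^†).
    by rewrite /y /X cstarD cstarZr x0s; linear_identity R[i].
  have -> : avg y N.+1 = (2 * l)%:C *: x0 + (s + s^† - (y - avg y N.+1)).
    by rewrite {2}yE; linear_identity R[i].
  apply: dist; apply: (fix_cobD autA).
    by apply: (fix_cobD autA) => //; exact: (fix_cob_star autA).
  rewrite -scaleN1r; apply: (fix_cobZ autA); apply: (fix_cob_cob autA).
  exact: (sub_avg_cob autA).
have G0e : G0 (e, 1).
  exists 0, 1, 0, 0; split => //; first exact: (cob0 autA).
  by rewrite /X !scale0r mul0r !addr0 oppr0 !add0r scale1r.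
have [F [FL Fpos FG]] := riesz_extension K0 KD KZ Ke G0s G0p G0e.
have FD (v w : A * A) : F (v + w) = F v + F w.
  by have := FL 1 v w; rewrite scale1r mul1r.
have Fsplit x y : F (x, y) = F (x, 0) + F (0, y).
  by rewrite -FD; congr F; rewrite /= -[LHS]/(x, y); congr (_, _); rewrite ?addr0 ?add0r.
(* [F] is 1 at (1, 1) and, as will follow from agreement on [fix_cob], equal at (1, 0) and (0, 1);
   the factor 2 makes both components unital. *)
pose f1 x := 2 * F (x, 0); pose f2 x := 2 * F (0, x).
have FS s w : fix_cob s -> cob w -> F (s, - s + w) = 0.
  move=> Ss Cw; apply: FG; exists 0, 0, s, w; split => //.
  by rewrite /X !scale0r mul0r !addr0 add0r.
have f12 s : fix_cob s -> f1 s = f2 s.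
  move=> Ss; have := FS _ _ Ss (cob0 autA); rewrite addr0 Fsplit.
  have -> : F (0, - s) = - F (0, s).
    have := FD (0, s) (0, - s).
    have -> : (0, s) + (0, - s) = 0 :> (A * A)%type.
      by congr (_, _); rewrite /= ?addr0 ?subrr.
    have := FD 0 0; rewrite addr0; lra.
  by rewrite /f1 /f2; lra.
have f1cob w : cob w -> f1 w = 0.
  move=> Cw; have := FS _ _ (fix_cob_cob autA Cw) Cw.
  by rewrite addNr /f1 => ->; rewrite mulr0.
have f2cob w : cob w -> f2 w = 0.
  by move=> Cw; rewrite -f12 ?f1cob//; exact: (fix_cob_cob autA).
have f1L (t : R) x y : f1 (t%:C *: x + y) = t * f1 x + f1 y.
  rewrite /f1; have := FL t (x, 0) (y, 0).
  have -> : t%:C *: (x, 0) + (y, 0) = (t%:C *: x + y, 0) :> (A * A)%type.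
    by congr (_, _); rewrite /= ?scaler0 ?addr0.
  by lra.
have f2L (t : R) x y : f2 (t%:C *: x + y) = t * f2 x + f2 y.
  rewrite /f2; have := FL t (0, x) (0, y).
  have -> : t%:C *: (0, x) + (0, y) = (0, t%:C *: x + y) :> (A * A)%type.
    by congr (_, _); rewrite /= ?scaler0 ?addr0.
  by lra.
have f1p x : cpos (x + x^†) -> 0 <= f1 x.
  move=> xp; rewrite /f1 mulr_ge0//; apply: Fpos; split => //=.
  by rewrite cstar0 addr0; exact: cpos0.
have f2p x : cpos (x + x^†) -> 0 <= f2 x.
  move=> xp; rewrite /f2 mulr_ge0//; apply: Fpos; split => //=.
  by rewrite cstar0 addr0; exact: cpos0.
have f1e : f1 1c = 1.
  have := FG _ _ G0e; rewrite Fsplit.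
  have := f12 _ (fix_cob_fix autA (fix1 autA)); rewrite /f1 /f2; lra.
have f2e : f2 1c = 1 by rewrite -f12//; apply: (fix_cob_fix autA); exact: (fix1 autA).
have inv (f : A -> R) : (forall (t : R) x y, f (t%:C *: x + y) = t * f x + f y) ->
    (forall w, cob w -> f w = 0) ->
    forall x, complexify f (alpha x) = complexify f x.
  move=> fL fcob x.
  have fa y : f (alpha y) = f y.
    have := fcob (y - alpha y); rewrite (rlinD fL) (rlinN fL) => H.
    by apply/eqP; rewrite eq_sym -subr_eq0 H//; exists y.
  by rewrite /complexify -(autZ autA) !fa.
exists (complexify f1), (complexify f2); split.
- by split; exact: complexify_state.
- by rewrite (complexify_self f1L f1p (cstar1 cA)) f1e.
- by split; exact: inv.
- move=> x fx; rewrite /complexify !f12//; apply: (fix_cob_fix autA) => //.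
  exact: (fixZ autA).
move=> /(congr1 (fun g => complex.Re (g x0))) /= eqf.
have : F (x0, - x0) = d.
  apply: FG; exists 1, 0, 0, 0; split => //; first exact: (cob0 autA).
  by rewrite /X scale1r scale0r mul1r !addr0.
rewrite Fsplit.
have := rlinN f2L x0; rewrite /f2; move: eqf; rewrite /f1 /f2; lra.
Qed.

End Separation.

(** * The mean ergodic theorem *)

Section MeanErgodic.
Variables (R : realType) (A : completeNormedModType R[i]) (cA : CStarAlgebra A).

Local Notation "x ** y" := (cmul cA x y) (at level 40, left associativity).
Local Notation "x ^†" := (cstar cA x) (at level 2, format "x ^†").
Local Notation "1c" := (cone cA).
Local Notation cpos := (cpos cA).
Variables (alpha : A -> A) (autA : is_automorphism cA alpha).
Implicit Types (x y z a b w : A) (t : R).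

Local Notation avg := (ergodic_avg alpha).
Local Notation fixa := (fixed_pts alpha).
Local Notation cob := (coboundaries alpha).
Local Notation fix_cob := (fix_cob alpha).

Lemma rcvg_unique (u : nat -> A) l l' : rcvg u l -> rcvg u l' -> l = l'.
Proof. by move=> /rcvgP ul /rcvgP; apply: cvg_unique. Qed.

Lemma rcvgD (u v : nat -> A) l m : rcvg u l -> rcvg v m ->
  rcvg (fun n => u n + v n) (l + m).
Proof. by move=> /rcvgP ul /rcvgP vm; apply/rcvgP; exact: cvgD. Qed.

Lemma rcvgZ (c : R[i]) (u : nat -> A) l : rcvg u l ->
  rcvg (fun n => c *: u n) (c *: l).
Proof. by move=> /rcvgP ul; apply/rcvgP; exact: cvgZr. Qed.

Lemma dense_avg_cvg : closure fix_cob = setT -> forall a, cvg (avg a @ \oo).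
Proof.
move=> dense a.
suff [l /rcvgP al] : exists l, rcvg (avg a) l by apply/cvg_ex; exists l.
(* One error e/4 comes from a - s, another from the averages of w; together they keep the averages
   of [a] within e/2 of b. *)
apply: rcauchy_cvg => e e0; have e40 : 0 < e / 4 by lra.
have /rclosureP/(_ _ e40)[s [b [w [fb [cw sE]]]] as_] : closure fix_cob a.
  by rewrite dense.
have [N HN] := rcvg_avg_coboundary autA cw e40.
have near n : (N.+1 <= n)%N -> rnorm (avg a n - b) < e / 2.
  case: n => // n Nn.
  have -> : avg a n.+1 - b = avg (a - s) n.+1 + (avg w n.+1 - 0).
    rewrite sE (avgB autA) (avgD autA) (avg_fixed _ fb).
    by linear_identity R[i].
  have := rnormD (avg (a - s) n.+1) (avg w n.+1 - 0).
  by have := rnorm_avg autA n.+1 (a - s); have := HN n.+1 (ltnW Nn); lra.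
exists N.+1 => m n Nm Nn.
have -> : avg a m - avg a n = (avg a m - b) - (avg a n - b).
  by linear_identity R[i].
by have := rnormB (avg a m - b) (avg a n - b); have := near _ Nm; have := near _ Nn; lra.
Qed.

Lemma decomposition_dense :
  set_sum fixa (closure cob) = setT -> closure fix_cob = setT.
Proof.
move=> dec; apply/seteqP; split => // x _; apply/rclosureP => e e0.
have [b [c [fb [/rclosureP/(_ _ e0)[w cw wc] ->]]]] : set_sum fixa (closure cob) x.
  by rewrite dec.
exists (b + w); first by exists b, w.
by rewrite opprD addrACA subrr add0r.
Qed.

(** The bound in [bounded_on] is a complex number; evaluation at the unit shows that it is real and
    nonnegative. *)
Lemma bounded_onP (B : set A) (f : A -> R[i]) : B 1c -> bounded_on B f ->
  exists2 M : R, 0 <= M & forall x, B x -> `|f x| <= (M * rnorm x)%:C.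
Proof.
move=> B1 [M HM]; have M0 : 0 <= M.
  by have := HM _ B1; rewrite rnormE rnorm1 mulr1; apply: le_trans.
have Mr : M = (complex.Re M)%:C by rewrite RRe_real// ger0_real.
exists (complex.Re M); first by rewrite -ler0c -Mr.
by move=> x /HM; rewrite rmorphM /= -Mr -rnormE.
Qed.

Lemma invariant_extension_unique (g1 g2 : A -> R[i]) : closure fix_cob = setT ->
  linear_on setT g1 -> bounded_on setT g1 -> (forall x, g1 (alpha x) = g1 x) ->
  linear_on setT g2 -> bounded_on setT g2 -> (forall x, g2 (alpha x) = g2 x) ->
  (forall x, fixa x -> g1 x = g2 x) -> g1 = g2.
Proof.
move=> dense [g1D g1Z] /(bounded_onP I)[M1 M10 g1M] g1a.
move=> [g2D g2Z] /(bounded_onP I)[M2 M20 g2M] g2a g12.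
apply/funext => x; apply/eqP; rewrite -subr_eq0 -normr_le0.
have lin0 (g : A -> R[i]) : (forall x y, setT x -> setT y -> g (x + y) = g x + g y) ->
    (forall c x, setT x -> g (c *: x) = c * g x) ->
    (forall x, g (alpha x) = g x) -> forall w, cob w -> g w = 0.
  by move=> gD gZ ga _ [y _ <-]; rewrite gD// -scaleN1r gZ// ga mulN1r subrr.
have agree s : fix_cob s -> g1 s = g2 s.
  move=> [b [w [fb [cw ->]]]].
  rewrite g1D// g2D// g12//.
  by rewrite (lin0 g1 g1D g1Z g1a _ cw) (lin0 g2 g2D g2Z g2a _ cw).
pose c := complex.Re `|g1 x - g2 x|.
have cE : `|g1 x - g2 x| = c%:C by rewrite RRe_real// normr_real.
suff : c <= 0 by rewrite cE -lecR.
apply/ler_addgt0Pr => e e0; rewrite add0r.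
have M0 : 0 < M1 + M2 + 1 by lra.
have /rclosureP/(_ (e / (M1 + M2 + 1)))[|s Ss xs] : closure fix_cob x.
- by rewrite dense.
- exact: divr_gt0.
have : c <= (M1 + M2) * rnorm (x - s).
  rewrite -lecR -cE.
  have -> : g1 x - g2 x = g1 (x - s) - g2 (x - s).
    by rewrite -[- s]scaleN1r g1D// g2D// g1Z// g2Z// (agree s)//; ring.
  apply: (le_trans (ler_normB _ _)); rewrite mulrDl rmorphD /=.
  by apply: lerD; [exact: g1M|exact: g2M].
move: xs; rewrite ltr_pdivlMr//; have := rnorm_ge0 (x - s); nra.
Qed.

(** * The limit of the averages as a conditional expectation *)

Section Limit.
Hypothesis avg_cvg : forall a, cvg (avg a @ \oo).

Definition mean_limit a : A := lim (avg a @ \oo).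
Local Notation E := mean_limit.

Lemma rcvg_mean_limit a : rcvg (avg a) (E a).
Proof. exact/rcvgP/avg_cvg. Qed.

Lemma mean_limitD x y : E (x + y) = E x + E y.
Proof.
apply: rcvg_unique (rcvg_mean_limit _) _.
have := rcvgD (rcvg_mean_limit x) (rcvg_mean_limit y).
by congr rcvg; apply/funext => n; rewrite (avgD autA).
Qed.

Lemma mean_limitZ (c : R[i]) x : E (c *: x) = c *: E x.
Proof.
apply: rcvg_unique (rcvg_mean_limit _) _.
have := rcvgZ c (rcvg_mean_limit x).
by congr rcvg; apply/funext => n; rewrite (avgZ autA).
Qed.

Lemma mean_limit_fixed b : fixa b -> E b = b.
Proof.
move=> fb; apply: rcvg_unique (rcvg_mean_limit _) _ => e e0.
by exists 1%N => -[//|n] _; rewrite (avg_fixed _ fb) subrr rnorm0.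
Qed.

Lemma rnorm_mean_limit x : rnorm (E x) <= rnorm x.
Proof. by apply: rcvg_rnorm_le (rcvg_mean_limit x) => n; exact: (rnorm_avg autA). Qed.

Lemma mean_limit_inv x : E (alpha x) = E x.
Proof.
have Ecob : E (x - alpha x) = 0.
  apply: rcvg_unique (rcvg_mean_limit _) _; apply: (rcvg_avg_coboundary autA).
  by exists x.
rewrite -{2}(subrK (alpha x) x) mean_limitD Ecob add0r //.
Qed.

(** As [alpha] is contractive and commutes with averaging, the averages of alpha(x) converge to
    alpha(E x) as well as to E(alpha x) = E x. *)
Lemma mean_limit_mem x : fixa (E x).
Proof.
rewrite /fixed_pts /= -[RHS]mean_limit_inv.
apply: rcvg_unique _ (rcvg_mean_limit _) => e /(rcvg_mean_limit x)[N HN].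
exists N => n /HN; apply: le_lt_trans.
suff -> : avg (alpha x) n = alpha (avg x n).
  by rewrite -(autB autA); exact: (rnorm_aut autA).
rewrite /ergodic_avg (autZ autA); congr (_ *: _).
elim: (n) => [|m IH]; first by rewrite !big_ord0 (aut0 autA).
by rewrite !big_ord_recr /= (autD autA) IH -iterSr.
Qed.

Lemma sub_mean_limit_closure x : closure cob (x - E x).
Proof.
apply/rclosureP => e /(rcvg_mean_limit x)[N /(_ N.+1 (leqnSn N)) HN].
exists (x - avg x N.+1); first exact: (sub_avg_cob autA).
by rewrite opprB addrACA [X in rnorm X](_ : _ = avg x N.+1 - E x)//; linear_identity R[i].
Qed.

Lemma mean_limit_cpos x : cpos x -> cpos (E x).
Proof.
move=> xp; apply: rcvg_cpos (rcvg_mean_limit x) => n; first exact: (cpos_avg autA).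
exact: (rnorm_avg autA).
Qed.

Lemma mean_limit_linear_on (f : A -> R[i]) :
  linear_on fixa f -> linear_on setT (f \o E).
Proof.
move=> [fD fZ]; split=> [x y _ _|c x _] /=.
  by rewrite mean_limitD fD//; exact: mean_limit_mem.
by rewrite mean_limitZ fZ//; exact: mean_limit_mem.
Qed.

Lemma mean_limit_bounded_on (f : A -> R[i]) :
  bounded_on fixa f -> bounded_on setT (f \o E).
Proof.
move=> /(bounded_onP (fix1 autA))[M M0 fM]; exists M%:C => x _ /=.
apply: (le_trans (fM _ (mean_limit_mem x))).
by rewrite rnormE -rmorphM lecR ler_wpM2l// rnorm_mean_limit.
Qed.

Lemma mean_limit_state (f : A -> R[i]) :
  state_on cA fixa f -> state_on cA setT (f \o E).
Proof.
move=> [fL [fp [fn fe]]]; split; first exact: mean_limit_linear_on.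
split=> [b _|].
  (* [f] is known to be positive only on products k^† k with k fixed; the root of the positive fixed
     element E(b^† b) is such a k. *)
  have /cpos_sqrt[k [ks _ kk _ kfix]] := mean_limit_cpos (cpos_starM cA b).
  rewrite /= -kk -{1}ks; apply: fp; apply: kfix => //; exact: mean_limit_mem.
split=> [x _|e /fe[x [fx [x1 ex]]]] /=.
  apply: (le_trans (fn _ (mean_limit_mem x))).
  by rewrite !rnormE lecR rnorm_mean_limit.
by exists x; rewrite mean_limit_fixed.
Qed.

Lemma mean_limit_cond_exp : cond_exp fixa E.
Proof.
split; first exact: mean_limitD.
split; first exact: mean_limitZ.
split; first exact: mean_limit_mem.
split; first exact: mean_limit_fixed.
split; first by move=> x; rewrite !rnormE lecR rnorm_mean_limit.
move=> e e0; exists 1c; rewrite mean_limit_fixed ?rnormE ?rnorm1; last exact: (fix1 autA).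
by split=> //; rewrite gtrDl oppr_lt0.
Qed.

(** E' annihilates x - avg x and fixes E x, so E' x - E x = E'(avg x - E x), which tends to 0 by
    contractivity. *)
Lemma cond_exp_mean_limit (E' : A -> A) : cond_exp fixa E' ->
  (forall x, E' (alpha x) = E' x) -> E' = E.
Proof.
move=> [E'D [E'Z [_ [E'fix [E'n _]]]]] E'inv; apply/funext => x.
have E'cob w : cob w -> E' w = 0.
  by move=> [y _ <-]; rewrite E'D -scaleN1r E'Z E'inv scaleN1r subrr.
apply/eqP; rewrite -subr_eq0; apply/eqP; apply: rnorm_lt_eq0 => e.
move=> /(rcvg_mean_limit x)[N /(_ N.+1 (leqnSn N))].
apply: le_lt_trans; rewrite -lecR -!rnormE.
have -> : E' x - E x = E' (avg x N.+1 - E x).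
  rewrite E'D -[- E x]scaleN1r (E'Z (-1)) (E'fix _ (mean_limit_mem x)) scaleN1r.
  congr (_ - _); rewrite -{1}(subrK (avg x N.+1) x) E'D E'cob ?add0r//.
  exact: (sub_avg_cob autA).
exact: E'n.
Qed.

End Limit.

(** Without density, the two separating states would be distinct invariant extensions of one
    functional. *)
Lemma invariant_extension_dense :
  (forall f : A -> R[i], linear_on fixa f -> bounded_on fixa f ->
     exists! g : A -> R[i], linear_on setT g /\ bounded_on setT g /\
       (forall x, g (alpha x) = g x) /\ (forall x, fixa x -> g x = f x)) ->
  closure fix_cob = setT.
Proof.
move=> ext; apply/eqP; apply: contrapT => /negP.
move=> /(separating_states autA)[g1 [g2 [[st1 st2] _ [inv1 inv2] agree neq]]].
have bounded B g : state_on cA setT g -> bounded_on B g.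
  by move=> [_ [_ [gn _]]]; exists 1 => x _; rewrite mul1r gn.
have [L1 _] := st1; have [L2 _] := st2.
have [|g [_ uni]] := ext g1 _ (bounded fixa _ st1).
  by case: L1 => gD gZ; split=> *; [exact: gD|exact: gZ].
apply: neq; rewrite -(uni g1); last by split=> //; split=> //; exact: bounded.
apply: uni; split=> //; split; first exact: bounded.
by split=> // x fx; rewrite agree.
Qed.

Lemma invariant_state_extension_dense :
  (forall f : A -> R[i], state_on cA fixa f ->
     exists! g : A -> R[i], state_on cA setT g /\
       (forall x, g (alpha x) = g x) /\ (forall x, fixa x -> g x = f x)) ->
  closure fix_cob = setT.
Proof.
move=> ext; apply/eqP; apply: contrapT => /negP.
move=> /(separating_states autA)[g1 [g2 [[st1 st2] g11 [inv1 inv2] agree neq]]].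
have [|g [_ uni]] := ext g1.
  have [[gD gZ] [gp [gn _]]] := st1.
  split; first by split=> *; [exact: gD|exact: gZ].
  split; first by move=> b _; exact: gp.
  split=> [x _|e e0]; first exact: gn.
  (* The restriction to the fixed points still has norm one because the unit is fixed and g1(1) =
     1. *)
  exists 1c; split; first exact: (fix1 autA).
  by rewrite g11 normr1 rnormE rnorm1 gtrDl oppr_lt0.
apply: neq; rewrite -(uni g1)//; apply: uni; split=> //.
by split=> // x fx; rewrite agree.
Qed.

End MeanErgodic.
Unset Implicit Arguments.

Theorem theorem3p2 (R : realType) (A : completeNormedModType R[i])
    (cA : CStarAlgebra A) (alpha : A -> A) :
  is_automorphism cA alpha ->
  let Aa := fixed_pts alpha in
  [<->
    (* (i) *)
    (forall f : A -> R[i], linear_on Aa f -> bounded_on Aa f ->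
       exists! g : A -> R[i], linear_on setT g /\ bounded_on setT g /\
         (forall x, g (alpha x) = g x) /\ (forall x, Aa x -> g x = f x));
    (* (ii) *)
    (forall f : A -> R[i], state_on cA Aa f ->
       exists! g : A -> R[i], state_on cA setT g /\
         (forall x, g (alpha x) = g x) /\ (forall x, Aa x -> g x = f x));
    (* (iii) *)
    closure (set_sum Aa (coboundaries alpha)) = setT;
    (* (iv) *)
    (forall a : A, cvg (ergodic_avg alpha a @ \oo));
    (* (v) *)
    set_sum Aa (closure (coboundaries alpha)) = setT ]
  /\
  ((forall f : A -> R[i], linear_on Aa f -> bounded_on Aa f ->
       exists! g : A -> R[i], linear_on setT g /\ bounded_on setT g /\
         (forall x, g (alpha x) = g x) /\ (forall x, Aa x -> g x = f x)) ->
   (exists! E : A -> A, cond_exp Aa E /\ (forall x, E (alpha x) = E x)) /\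
   (forall E : A -> A, cond_exp Aa E -> (forall x, E (alpha x) = E x) ->
      forall a : A, ergodic_avg alpha a @ \oo --> E a)).
Proof.
move=> autA Aa.
have dense_ext : closure (fix_cob alpha) = setT ->
    (forall f : A -> R[i], linear_on Aa f -> bounded_on Aa f ->
       exists! g : A -> R[i], linear_on setT g /\ bounded_on setT g /\
         (forall x, g (alpha x) = g x) /\ (forall x, Aa x -> g x = f x)).
  move=> dense f fL fb; have cv := dense_avg_cvg autA dense.
  exists (f \o mean_limit alpha); split.
    split; first exact: (mean_limit_linear_on autA cv).
    split; first exact: (mean_limit_bounded_on autA cv).
    split=> [x|x fx] /=; first by rewrite (mean_limit_inv autA cv).
    by rewrite mean_limit_fixed.
  move=> g [gL [gb [ga gf]]].
  apply: (invariant_extension_unique cA dense) => //.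
  - exact: (mean_limit_linear_on autA cv).
  - exact: (mean_limit_bounded_on autA cv).
  - by move=> x /=; rewrite (mean_limit_inv autA cv).
  - by move=> x fx /=; rewrite mean_limit_fixed// gf.
split.
  (* The implications form the cycle (i), (ii), (iii), (iv), (v), (i). The first and the last pass
     through density. *)
  tfae.
  - move=> /(invariant_extension_dense autA) dense f fs.
    have cv := dense_avg_cvg autA dense.
    have bounded B g : state_on cA setT g -> bounded_on B g.
      by move=> [_ [_ [gn _]]]; exists 1 => x _; rewrite mul1r gn.
    have Es := mean_limit_state autA cv fs.
    exists (f \o mean_limit alpha); split.
      split=> //; split=> [x|x fx] /=; first by rewrite (mean_limit_inv autA cv).
      by rewrite mean_limit_fixed.
    move=> g [gs [ga gf]].
    apply: (invariant_extension_unique cA dense) => //.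
    + by case: Es.
    + exact: bounded.
    + by move=> x /=; rewrite (mean_limit_inv autA cv).
    + by case: gs.
    + exact: bounded.
    + by move=> x fx /=; rewrite mean_limit_fixed// gf.
  - exact: invariant_state_extension_dense.
  - exact: (dense_avg_cvg autA).
  - move=> cv; apply/seteqP; split=> // x _.
    exists (mean_limit alpha x), (x - mean_limit alpha x).
    split; first exact: (mean_limit_mem autA cv).
    by split; [exact: (sub_mean_limit_closure autA cv)|rewrite addrC subrK].
  - by move=> /decomposition_dense/dense_ext.
move=> /(invariant_extension_dense autA)/(dense_avg_cvg autA) cv.
split; last first.
  move=> E cE Einv a; rewrite (cond_exp_mean_limit autA cv cE Einv).
  exact/rcvgP/rcvg_mean_limit.
exists (mean_limit alpha); split.
  split; first exact: (mean_limit_cond_exp autA cv).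
  exact: (mean_limit_inv autA cv).
by move=> E [cE Einv]; rewrite (cond_exp_mean_limit autA cv cE Einv).
Qed.
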